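(* Let $\mathcal P$ be a $(\lambda_1,\lambda_2)$-good grid of a finite measure space $(I,\mathbb A,m)$, $p\in[1,\infty)$, $q\in[1,\infty]$ and $0<s<1/p$. Let $g\in\mathcal B^{1/p}_{p,\infty}\cap L^\infty$. Then the multiplier operator $G:\mathcal B^s_{p,q}\to\mathcal B^s_{p,q}$ defined by $G(f)=gf$ is a well-defined and bounded operator acting on $(\mathcal B^s_{p,q},|\cdot|_{\mathcal B^s_{p,q}})$. Indeed its operator norm satisfies $$|G|_{\mathcal B^s_{p,q}}\le C_eC_o\,\frac{|g|_{\mathcal B^{1/p}_{p,\infty}}}{1-\lambda_2^{1/p-s}}+|g|_\infty,$$ where $$C_e=1+C_H\,\lambda_1^{-2-1/p},\qquad C_H=\frac{\lambda_2^{1/2}}{\sqrt2\,\lambda_1^{3/2}}+1,\qquad C_o=|I|^{-1/p}\sum_k|\mathcal P^k|^{1/p}+\frac1{1-\lambda_2^{1/p}}.$$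
   Context: $|J|=m(J)$; $\mathbb N=\{0,1,\dots\}$; $|\mathcal P^k|=\max\{|Q|:Q\in\mathcal P^k\}$; sup modification when an exponent is $\infty$. Good grid ($0<\lambda_1<\lambda_2<1$): a sequence $\mathcal P=(\mathcal P^k)_{k\in\mathbb N}$ of finite families of measurable sets of positive measure with: $\mathcal P^0=\{I\}$; $I=\bigcup_{Q\in\mathcal P^k}Q$ up to a null set; the elements of $\mathcal P^k$ are pairwise disjoint; every $Q\in\mathcal P^k$, $k>0$, is contained in some $P\in\mathcal P^{k-1}$; $\lambda_1\le|Q|/|P|\le\lambda_2$ whenever $Q\subset P$, $Q\in\mathcal P^{k+1}$, $P\in\mathcal P^k$; $\bigcup_k\mathcal P^k$ generates $\mathbb A$. For any $s>0$ and $q\in[1,\infty]$: an $(s,p)$-Souza's atom on $Q\in\bigcup_k\mathcal P^k$ is a function constant on $Q$, zero outside $Q$, with sup norm $\le|Q|^{s-1/p}$. $\mathcal B^s_{p,q}$ is the set of complex $g\in L^p$ which can be written $g=\sum_k\sum_{Q\in\mathcal P^k}s_Qa_Q$ with $a_Q$ an $(s,p)$-Souza's atom on $Q$, $s_Q\in\mathbb C$, $\sum_k|\sum_{Q\in\mathcal P^k}s_Qa_Q|_p<\infty$ and finite cost $(\sum_k(\sum_{Q\in\mathcal P^k}|s_Q|^p)^{q/p})^{1/q}$; $|g|_{\mathcal B^s_{p,q}}$ is the infimum of the costs. *)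

(* Defs.v *)
From HB Require Import structures.
From mathcomp Require Import all_boot all_order all_algebra.
From mathcomp Require Import all_classical all_reals all_analysis.
From mathcomp Require Import complex.

Set Implicit Arguments.
Unset Strict Implicit.
Unset Printing Implicit Defensive.

Import Order.TTheory GRing.Theory Num.Theory.
Import numFieldNormedType.Exports.

Local Open Scope classical_set_scope.
Local Open Scope ring_scope.

Notation cabs := ComplexField.Normc.normc.

Definition cmeasurable (R : realType) (d : measure_display)
    (T : measurableType d) (f : T -> R[i]) : Prop :=
  measurable_fun setT (fun x => complex.Re (f x)) /\
  measurable_fun setT (fun x => complex.Im (f x)).

Definition cLnorm (R : realType) (d : measure_display) (T : measurableType d)
    (mu : {measure set T -> \bar R}) (r : \bar R) (f : T -> R[i]) : \bar R :=
  Lnorm mu r (fun x => (cabs (f x))%:E).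

(* Elements of L^r are represented by functions; classes modulo a.e. equality
   are not formed. *)
Definition cLp (R : realType) (d : measure_display) (T : measurableType d)
    (mu : {measure set T -> \bar R}) (r : \bar R) : set (T -> R[i]) :=
  [set f | cmeasurable f /\ (cLnorm mu r f < +oo)%E].

Definition good_grid (R : realType) (d : measure_display)
    (T : measurableType d) (mu : {measure set T -> \bar R})
    (lambda1 lambda2 : R) (P : nat -> set (set T)) : Prop :=
  [/\ 0 < lambda1, lambda1 < lambda2 & lambda2 < 1] /\
  [/\ forall k, finite_set (P k),
      forall k Q, P k Q -> measurable Q /\ (0 < mu Q)%E &
      P 0%N = [set setT]] /\
  [/\ forall k, mu (~` \bigcup_(Q in P k) Q) = 0%E,
      forall k Q Q', P k Q -> P k Q' -> Q <> Q' -> Q `&` Q' = set0,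
      forall k Q, P k.+1 Q -> exists2 Q', P k Q' & Q `<=` Q',
      forall k Q Q', P k.+1 Q -> P k Q' -> Q `<=` Q' ->
        lambda1 <= fine (mu Q) / fine (mu Q') <= lambda2 &
      <<s \bigcup_k P k >> = @measurable d T].

(* In a good grid, [P k] is finite and nonempty, so this supremum is a
   maximum. *)
Definition grid_size (R : realType) (d : measure_display)
    (T : measurableType d) (mu : {measure set T -> \bar R})
    (P : nat -> set (set T)) (k : nat) : R :=
  sup [set fine (mu Q) | Q in P k].

Definition souza_atom (R : realType) (d : measure_display)
    (T : measurableType d) (mu : {measure set T -> \bar R}) (s p : R)
    (Q : set T) : set (T -> R[i]) :=
  [set a | [/\ exists z, forall x, Q x -> a x = z,
               forall x, ~ Q x -> a x = 0 &
               forall x, cabs (a x) <= fine (mu Q) `^ (s - p^-1)]].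

(* Coefficients and atoms are indexed by the cells alone, without the level:
   in a good grid a cell belongs to exactly one [P k], since it is strictly
   smaller than its ancestors and each [P k] is disjoint. *)
Definition block (R : realType) (T : Type) (P : nat -> set (set T))
    (c : set T -> R[i]) (a : set T -> T -> R[i]) (k : nat) (x : T) : R[i] :=
  \sum_(Q \in P k) c Q * a Q x.

(* [g] is the sum of the blocks in L^p, the series being absolutely convergent
   in L^p. *)
Definition souza_representation (R : realType) (d : measure_display)
    (T : measurableType d) (mu : {measure set T -> \bar R})
    (P : nat -> set (set T)) (s p : R) (g : T -> R[i])
    (c : set T -> R[i]) (a : set T -> T -> R[i]) : Prop :=
  [/\ forall k Q, P k Q -> souza_atom mu s p Q (a Q),
      (\sum_(0 <= k <oo) cLnorm mu p%:E (block P c a k) < +oo)%E &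
      cLnorm mu p%:E (fun x => g x - \sum_(0 <= k < n) block P c a k x)
        @[n --> \oo] --> 0%E].

(* Only used for [1 <= q], so that the last branch is the case [q = +oo]. *)
Definition cost (R : realType) (T : Type) (P : nat -> set (set T)) (p : R)
    (q : \bar R) (c : set T -> R[i]) : \bar R :=
  match q with
  | r%:E => ((\sum_(0 <= k <oo)
      ((\sum_(Q \in P k) cabs (c Q) `^ p) `^ (r / p))%:E) `^ r^-1)%E
  | _ => ereal_sup [set ((\sum_(Q \in P k) cabs (c Q) `^ p) `^ p^-1)%:E
                     | k in setT]
  end.

Definition besov (R : realType) (d : measure_display)
    (T : measurableType d) (mu : {measure set T -> \bar R})
    (P : nat -> set (set T)) (s p : R) (q : \bar R) : set (T -> R[i]) :=
  [set g | cLp mu p%:E g /\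
     exists c a, souza_representation mu P s p g c a /\ (cost P p q c < +oo)%E].

Definition besov_norm (R : realType) (d : measure_display)
    (T : measurableType d) (mu : {measure set T -> \bar R})
    (P : nat -> set (set T)) (s p : R) (q : \bar R) (g : T -> R[i]) : \bar R :=
  ereal_inf [set cost P p q c | c in
    [set c | exists a, souza_representation mu P s p g c a /\
                       (cost P p q c < +oo)%E]].

Definition multiplier (R : realType) (T : Type) (g f : T -> R[i]) : T -> R[i] :=
  fun x => g x * f x.

(* A bounded linear operator on the space of a.e. classes of elements of [V];
   compatibility with a.e. equality makes [G] well defined on classes. *)
Definition bounded_operator (R : realType) (d : measure_display)
    (T : measurableType d) (mu : {measure set T -> \bar R})
    (V : set (T -> R[i])) (N : (T -> R[i]) -> \bar R)
    (G : (T -> R[i]) -> (T -> R[i])) : Prop :=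
  [/\ forall f, V f -> V (G f),
      forall f h, V f -> V h -> {ae mu, forall x, f x = h x} ->
        {ae mu, forall x, G f x = G h x},
      forall (z : R[i]) f h, V f -> V h ->
        {ae mu, forall x, G (fun y => z * f y + h y) x = z * G f x + G h x} &
      exists M : R, forall f, V f -> (N (G f) <= M%:E * N f)%E].

Definition operator_norm (R : realType) (T : Type)
    (V : set (T -> R[i])) (N : (T -> R[i]) -> \bar R)
    (G : (T -> R[i]) -> (T -> R[i])) : \bar R :=
  ereal_sup [set N (G f) | f in [set f | V f /\ (N f <= 1)%E]].

Definition C_H (R : realType) (lambda1 lambda2 : R) : R :=
  lambda2 `^ (1 / 2) / (Num.sqrt 2 * lambda1 `^ (3 / 2)) + 1.

Definition C_e (R : realType) (lambda1 lambda2 p : R) : R :=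
  1 + C_H lambda1 lambda2 * lambda1 `^ (- 2 - 1 / p).

(* Extended-real valued only because of the series, which is finite in a good
   grid. *)
Definition C_o (R : realType) (d : measure_display)
    (T : measurableType d) (mu : {measure set T -> \bar R})
    (P : nat -> set (set T)) (lambda2 p : R) : \bar R :=
  ((fine (mu setT) `^ (- (1 / p)))%:E *
     \sum_(0 <= k <oo) (grid_size mu P k `^ (1 / p))%:E
   + (1 / (1 - lambda2 `^ (1 / p)))%:E)%E.

(* Main.v *)
(** Let [g_k] be the conditional expectation of [g] on the cells of [P k] and
    [F_k] the partial sums of a representation of [f]. Then
      [g f = lim g_k F_k = \sum_k (g_k (F_k - F_(k-1)) + (g_k - g_(k-1)) F_(k-1))],
    and the k-th term is constant on the cells of [P k], so that this is an
    atomic representation of [g f]. The first part costs at most [|g|_oo] times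
    the cost of [f], since [|g_k| <= |g|_oo]. On a cell [W] of [P k],
      [|W|^(1/p-s) |F_(k-1)| <= \sum_(j < k) (lambda2^(1/p-s))^(k-j) E_j],
    where [E_j] is the l^p norm of the coefficients of [f] at level [j]; the
    second part is therefore controlled by Young's inequality (a convolution
    with a geometric sequence) and by the l^p norms over [P k] of
    [g_k - g_(k-1)]. In the latter, the blocks of [g] of level [< k] cancel, and
    averaging a block of level [i >= k] over the cells of [P k] contracts its
    l^p norm by [lambda2^((i-k)/p)]. *)

Require Import Defs.
From HB Require Import structures.
From mathcomp Require Import all_boot all_order all_algebra.
From mathcomp Require Import all_classical all_reals all_analysis.
From mathcomp Require Import measurable_realfun ess_sup_inf complex ring lra.

Set Implicit Arguments.
Unset Strict Implicit.
Unset Printing Implicit Defensive.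

Import Order.TTheory GRing.Theory Num.Theory.
Import numFieldNormedType.Exports.

Local Open Scope classical_set_scope.
Local Open Scope ring_scope.

(** * Finite l^p sums *)

(** Averages of [g] are used instead of the partial sums of a representation of [g] because the
    latter are not controlled by [|g|_oo], while averages inherit the bound. Averages also do not
    depend on a representation: once their oscillation is bounded by the cost of an arbitrary
    representation, it is bounded by the norm of [g]. The price is that on a cell of [P k] the value
    of [g_(k-1)] is the average over the parent cell. Each parent is counted once per child, at most
    [1 / lambda1] times, whence a factor [1 + lambda1^(-1/p)]. Summing the contractions over the
    levels gives the constant [(1 + lambda1^(-1/p)) / (1 - lambda2^(1/p))], and [C_e * C_o]
    dominates it factor by factor. The two conditions on [s] act in different places: [s < 1/p]
    makes the coarse blocks of [f] small on fine cells, and [s > 0] makes the blocks of the product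
    absolutely summable in L^p. *)

Lemma powR_exprn (R : realType) (x t : R) n : 0 <= x ->
  (x ^+ n) `^ t = (x `^ t) ^+ n.
Proof.
move=> x0; rewrite -(powR_mulrn n x0) -(powR_mulrn n (powR_ge0 x t)).
by rewrite -!powRrM mulrC.
Qed.

Lemma sum_exprn_le (R : realType) (t : R) n : 0 < t -> t < 1 ->
  \sum_(i < n) t ^+ i <= (1 - t)^-1.
Proof.
move=> t0 t1; have := @geometric_le_lim R n 1 t ler01 t0.
rewrite ger0_norm ?(ltW t0)// mul1r => /(_ t1); apply: le_trans.
by rewrite /series/= big_mkord; apply: ler_sum => i _; rewrite mul1r.
Qed.

(* Young's inequality with exponents [p] and [p / (p - 1)]. *)
Lemma powR_tangent (R : realType) (x m p : R) : 1 <= p -> 0 <= x -> 0 <= m ->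
  x * m `^ (p - 1) <= x `^ p / p + m `^ p * (1 - p^-1).
Proof.
rewrite le_eqVlt => /predU1P[<- x0 _|p1 x0 m0].
  by rewrite subrr powRr0 invr1 subrr mulr0 addr0 powRr1// mulr1 divr1.
have p0 : 0 < p by lra.
have -> : m `^ p * (1 - p^-1) = (m `^ (p - 1)) `^ (p / (p - 1)) / (p / (p - 1)).
  rewrite -powRrM (_ : (p - 1) * _ = p); last by field; lra.
  by congr (_ * _); field; lra.
apply: conjugate_powR => //; rewrite ?powR_ge0//.
  by rewrite divr_gt0// subr_gt0.
by field; lra.
Qed.

(* Integrate the tangent line inequality at the mean [m]. *)
Lemma jensen_powR (R : realType) (I : Type) (r : seq I) (w x : I -> R) (p W : R) :
  1 <= p -> (forall i, 0 <= w i) -> (forall i, 0 <= x i) ->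
  \sum_(i <- r) w i <= W ->
  (\sum_(i <- r) w i * x i) `^ p <= W `^ (p - 1) * \sum_(i <- r) w i * x i `^ p.
Proof.
move=> p1 w0 x0 wW.
set M := \sum_(i <- r) w i * x i; set S := \sum_(i <- r) _ * _ `^ _.
have p0 : 0 < p by lra.
have M0 : 0 <= M by apply: sumr_ge0 => i _; rewrite mulr_ge0.
have S0 : 0 <= S by apply: sumr_ge0 => i _; rewrite mulr_ge0 ?powR_ge0.
have W0 : 0 <= W by apply: le_trans wW; exact: sumr_ge0.
have [Meq0|Mn0] := eqVneq M 0.
  by rewrite Meq0 powR0 ?gt_eqF// mulr_ge0 ?powR_ge0.
have Wpos : 0 < W.
  rewrite lt_neqAle W0 andbT; apply/eqP => Weq0.
  case/eqP: Mn0.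
  move: wW; rewrite -Weq0 /M; elim: (r) => [|i t IH]; first by rewrite !big_nil.
  rewrite !big_cons => wit.
  have wt0 : 0 <= \sum_(j <- t) w j by exact: sumr_ge0.
  have := w0 i => wi0; rewrite IH; last by lra.
  by rewrite addr0 (_ : w i = 0) ?mul0r//; lra.
have Mpos : 0 < M by rewrite lt_neqAle eq_sym Mn0.
(* [W] only bounds the total weight, so [m] need not be the true mean; the missing weight is charged
   to the constant term of the tangent, which is nonnegative. *)
pose m := M / W.
have m0 : 0 < m by rewrite divr_gt0.
have H : M * m `^ (p - 1) <= S / p + W * (m `^ p * (1 - p^-1)).
  apply: (@le_trans _ _
      (\sum_(i <- r) w i * (x i `^ p / p + m `^ p * (1 - p^-1)))).
    rewrite mulr_suml; apply: ler_sum => i _; rewrite -mulrA ler_wpM2l//.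
    by apply: powR_tangent => //; rewrite ltW.
  under eq_bigr do rewrite mulrDr mulrA.
  rewrite big_split/= -!mulr_suml lerD2l ler_wpM2r// mulr_ge0 ?powR_ge0//.
  by rewrite subr_ge0 invf_le1.
have MW : M = W * m by rewrite /m mulrC divfK// gt_eqF.
have H2 : W * m `^ p <= S.
  move: H; rewrite {1}MW -mulrA (mulr_powRB1 (ltW m0) p0) => H.
  have : W * m `^ p * p^-1 <= S * p^-1 by lra.
  by rewrite ler_pM2r ?invr_gt0.
rewrite MW powRM ?(ltW m0)// -(mulr_powRB1 W0 p0) (mulrC W) -mulrA.
by rewrite ler_wpM2l ?powR_ge0.
Qed.

(** Meant for nonnegative families: no absolute value is taken. *)
Definition lpsum (R : realType) (I : eqType) (r : seq I) (p : R) (x : I -> R) : R :=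
  (\sum_(i <- r) x i `^ p) `^ p^-1.

Section lpsum.
Context (R : realType) (I : eqType) (r : seq I) (p : R).
Hypothesis p1 : 1 <= p.
Implicit Types x y : I -> R.

Let p0 : 0 < p. Proof. by rewrite (lt_le_trans _ p1). Qed.

Lemma lpsum_ge0 x : 0 <= lpsum r p x.
Proof. exact: powR_ge0. Qed.

Lemma lpsum_powR x : lpsum r p x `^ p = \sum_(i <- r) x i `^ p.
Proof.
rewrite -powRrM mulVf ?gt_eqF// powRr1// sumr_ge0// => i _; exact: powR_ge0.
Qed.

Lemma le_lpsumP x a : 0 <= a ->
  (lpsum r p x <= a) = (\sum_(i <- r) x i `^ p <= a `^ p).
Proof.
move=> a0; rewrite -lpsum_powR; apply/idP/idP => h.
  by rewrite ge0_ler_powR ?nnegrE ?lpsum_ge0// ltW.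
rewrite leNgt; apply/negP => h2; move: h; rewrite leNgt => /negP; apply.
by rewrite gt0_ltr_powR ?nnegrE ?lpsum_ge0.
Qed.

(** Minkowski by convexity: [x i + y i] is [a + b] times the mean of [x i / a] and [y i / b] with
    weights proportional to [a] and [b], and both quotients have l^p norm at most 1. *)
Let sum_powRD x y (a b : R) : (forall i, 0 <= x i) -> (forall i, 0 <= y i) ->
  0 < a -> 0 < b ->
  \sum_(i <- r) x i `^ p <= a `^ p -> \sum_(i <- r) y i `^ p <= b `^ p ->
  \sum_(i <- r) (x i + y i) `^ p <= (a + b) `^ p.
Proof.
move=> x0 y0 a0 b0 xa yb.
have an : a != 0 := lt0r_neq0 a0.
have bn : b != 0 := lt0r_neq0 b0.
have convex i : (x i + y i) `^ p <=
    (a + b) `^ (p - 1) * (a * (x i / a) `^ p + b * (y i / b) `^ p).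
  have := @jensen_powR R bool [:: true; false]
    (fun c => if c then a else b)
    (fun c => if c then x i / a else y i / b) p (a + b) p1.
  rewrite !big_cons !big_nil !addr0 (mulrC a (x i / a)) (mulrC b (y i / b)).
  rewrite (divfK an) (divfK bn); apply => //.
  - by case; exact: ltW.
  - by case; rewrite divr_ge0// ltW.
have scale (c z : R) : 0 < c -> 0 <= z ->
    c * (z / c) `^ p = (c / c `^ p) * z `^ p.
  move=> c0 z0; have ci0 : 0 <= c^-1 by rewrite invr_ge0 ltW.
  rewrite (powRM _ z0 ci0) mulrCA [RHS]mulrC; congr (_ * (_ * _)).
  by rewrite -powR_inv1 ?(ltW c0)// -powRrM mulN1r powRN.
apply: (le_trans (ler_sum _ (fun i _ => convex i))).
rewrite -mulr_sumr big_split/=.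
rewrite (eq_bigr _ (fun i _ => scale a (x i) a0 (x0 i))).
rewrite (eq_bigr _ (fun i _ => scale b (y i) b0 (y0 i))).
rewrite -!mulr_sumr -(mulr_powRB1 (ltW (addr_gt0 a0 b0)) p0) [leRHS]mulrC.
rewrite ler_wpM2l ?powR_ge0// lerD//.
- by rewrite mulrAC ler_pdivrMr ?powR_gt0// ler_wpM2l// ltW.
- by rewrite mulrAC ler_pdivrMr ?powR_gt0// ler_wpM2l// ltW.
Qed.

Lemma lpsumD x y : (forall i, 0 <= x i) -> (forall i, 0 <= y i) ->
  lpsum r p (fun i => x i + y i) <= lpsum r p x + lpsum r p y.
Proof.
(* [sum_powRD] divides by its two bounds, and the norms may vanish; adding [e / 2] makes them
   positive. *)
move=> x0 y0; apply/ler_addgt0Pr => e e0.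
have e20 : 0 < e / 2 by rewrite divr_gt0.
have a0 : 0 < lpsum r p x + e / 2 by rewrite ltr_wpDl ?lpsum_ge0.
have b0 : 0 < lpsum r p y + e / 2 by rewrite ltr_wpDl ?lpsum_ge0.
rewrite [e in leRHS]splitr addrACA (le_lpsumP _ (ltW (addr_gt0 a0 b0))).
apply: sum_powRD => //.
- by rewrite -(le_lpsumP _ (ltW a0)) lerDl ltW.
- by rewrite -(le_lpsumP _ (ltW b0)) lerDl ltW.
Qed.

Lemma le_lpsum x y : {in r, forall i, 0 <= x i <= y i} ->
  lpsum r p x <= lpsum r p y.
Proof.
move=> xy; rewrite le_lpsumP ?lpsum_ge0// lpsum_powR !big_seq.
apply: ler_sum => i ir; have /andP[x0 xyi] := xy i ir.
by rewrite ge0_ler_powR ?nnegrE ?(le_trans x0 xyi)// ltW.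
Qed.

Lemma ler_lpsum x i : (forall i, 0 <= x i) -> i \in r -> x i <= lpsum r p x.
Proof.
move=> x0 ir.
have -> : x i = (x i `^ p) `^ p^-1 by rewrite -powRrM divff ?lt0r_neq0// powRr1.
have s0 : 0 <= \sum_(j <- r) x j `^ p by apply: sumr_ge0 => j _; exact: powR_ge0.
rewrite ge0_ler_powR ?nnegrE ?invr_ge0 ?powR_ge0 ?(ltW p0)//.
rewrite (big_rem i)//= lerDl; apply: sumr_ge0 => j _; exact: powR_ge0.
Qed.

Lemma lpsum_sum (J : Type) (s : seq J) (x : J -> I -> R) :
  (forall j i, 0 <= x j i) ->
  lpsum r p (fun i => \sum_(j <- s) x j i) <= \sum_(j <- s) lpsum r p (x j).
Proof.
move=> x0; elim: s => [|j s IH].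
  rewrite big_nil /lpsum; under eq_bigr do rewrite big_nil powR0 ?gt_eqF//.
  by rewrite big1// powR0// invr_eq0 gt_eqF.
have s0 i : 0 <= \sum_(k <- s) x k i by apply: sumr_ge0 => k _; exact: x0.
rewrite big_cons; apply: le_trans (lerD (lexx _) IH).
apply: le_trans (lpsumD (x0 j) s0).
by apply: le_lpsum => i _; rewrite big_cons lexx andbT addr_ge0 ?x0.
Qed.

Lemma lpsumZ c x : 0 <= c -> (forall i, 0 <= x i) ->
  lpsum r p (fun i => c * x i) = c * lpsum r p x.
Proof.
move=> c0 x0; rewrite /lpsum (eq_bigr _ (fun i _ => powRM p c0 (x0 i))).
rewrite -mulr_sumr powRM ?powR_ge0 ?sumr_ge0//; last by move=> i _; exact: powR_ge0.
by rewrite -powRrM divff ?gt_eqF// powRr1.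
Qed.

End lpsum.

(** * Young's inequality for sequences *)

(* As in [cost], the last branch is only meant for [q = +oo]. *)
Definition seq_norm (R : realType) (q : \bar R) (H : nat -> R) : \bar R :=
  match q with
  | r%:E => ((\sum_(0 <= k <oo) (H k `^ r)%:E) `^ r^-1)%E
  | _ => ereal_sup [set (H k)%:E | k in setT]
  end.

Lemma nneseries_le (R : realType) (u : nat -> \bar R) (M : \bar R) :
  (forall k, 0 <= u k)%E -> (forall n, \sum_(0 <= k < n) u k <= M)%E ->
  (\sum_(0 <= k <oo) u k <= M)%E.
Proof.
move=> u0 uM; apply: lime_le; first by apply: is_cvg_ereal_nneg_natsum.
by apply: nearW => n; exact: uM.
Qed.

(** Schur's test: the lower triangular kernel [w (k - j)] has row and column sums at most [W].
    Jensen along each row costs [W ^ (r - 1)]; exchanging the sums and adding up the columns gives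
    the last factor [W]. *)
Lemma sum_powR_conv (R : realType) (r W : R) (H E w : nat -> R) (n : nat) :
  1 <= r -> (forall k, 0 <= H k) -> (forall k, 0 <= E k) -> (forall k, 0 <= w k) ->
  (forall m, \sum_(i < m) w i <= W) ->
  (forall k, H k <= \sum_(j < k.+1) w (k - j)%N * E j) ->
  \sum_(k < n) H k `^ r <= W `^ r * \sum_(k < n) E k `^ r.
Proof.
move=> r1 H0 E0 w0 wW HE; have r0 : 0 < r by rewrite (lt_le_trans _ r1).
have W0 : 0 <= W by have := wW 0%N; rewrite big_ord0.
(* Without the test, truncated subtraction would give weight [w 0] to the entries with [j > k]. *)
pose v (k j : nat) := if (j <= k)%N then w (k - j)%N else 0.
have v0 k j : 0 <= v k j by rewrite /v; case: ifP.
have HE2 k : (k < n)%N -> H k <= \sum_(j < n) v k j * E j.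
  move=> kn; apply: le_trans (HE k) _.
  rewrite (big_ord_widen_cond n xpredT (fun j => w (k - j)%N * E j)) //.
  rewrite [leRHS](bigID (fun j : 'I_n => (j < k.+1)%N))/= -[leLHS]addr0 lerD//.
    by apply: ler_sum => j jk; rewrite /v -ltnS jk.
  by apply: sumr_ge0 => j _; rewrite mulr_ge0.
have vk k : (k < n)%N -> \sum_(j < n) v k j <= W.
  move=> kn; apply: le_trans (wW k.+1).
  rewrite (bigID (fun j : 'I_n => (j < k.+1)%N))/= [X in _ + X]big1 ?addr0; last first.
    by move=> j; rewrite /v ltnS => /negbTE ->.
  rewrite -(big_ord_widen_cond n xpredT (fun j => v k j))//.
  rewrite (reindex_inj rev_ord_inj)/=; apply: ler_sum => j _.
  by rewrite /v subSS leq_subr subKn// -ltnS.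
have vj (j : 'I_n) : \sum_(k < n) v k j <= W.
  apply: le_trans (wW (n - j)%N).
  rewrite -(big_mkord xpredT (fun k => v k j)) (@big_cat_nat _ _ _ j)//=;
    last exact: ltnW.
  rewrite big_nat_cond big1 ?add0r; last first.
    by move=> k /andP[/andP[_ kj] _]; rewrite /v leqNgt kj.
  rewrite -{1}[nat_of_ord j]add0n big_addn big_mkord; apply: ler_sum => k _.
  by rewrite /v leq_addl addnK.
apply: (@le_trans _ _ (\sum_(k < n) W `^ (r - 1) * \sum_(j < n) v k j * E j `^ r)).
  apply: ler_sum => k _; apply: le_trans (@jensen_powR R 'I_n _ (fun j => v k j)
    (fun j => E j) r W r1 (fun j => v0 k j) (fun j => E0 j) (vk _ (ltn_ord k))).
  rewrite ge0_ler_powR ?nnegrE ?(ltW r0)//; last exact: HE2.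
  by apply: sumr_ge0 => j _; rewrite mulr_ge0.
rewrite -mulr_sumr exchange_big/= -(mulr_powRB1 W0 r0) [W * _]mulrC -mulrA.
rewrite ler_wpM2l ?powR_ge0// mulr_sumr; apply: ler_sum => j _.
by rewrite -mulr_suml ler_wpM2r// powR_ge0.
Qed.

Section seq_norm.
Context (R : realType) (q : \bar R).
Hypothesis q1 : (1 <= q)%E.
Implicit Types H E w : nat -> R.

Lemma seq_norm_ge0 H : (forall k, 0 <= H k) -> (0 <= seq_norm q H)%E.
Proof.
case: q q1 => [r||//] r1 H0 /=; first exact: poweR_ge0.
apply: (@le_trans _ _ (H 0%N)%:E); first by rewrite lee_fin.
by apply: ereal_sup_ubound; exists 0%N.
Qed.

Lemma le_seq_norm H k : (forall k, 0 <= H k) -> ((H k)%:E <= seq_norm q H)%E.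
Proof.
case: q q1 => [r||//] r1 H0 /=; last by apply: ereal_sup_ubound; exists k.
rewrite lee_fin in r1; have r0 : 0 < r by rewrite (lt_le_trans _ r1).
have -> : (H k)%:E = ((H k `^ r)%:E `^ r^-1)%E.
  by rewrite poweR_EFin -powRrM divff ?gt_eqF// powRr1.
have Hr i : (0 <= (H i `^ r)%:E)%E by rewrite lee_fin powR_ge0.
have HS : ((H k `^ r)%:E <= \sum_(0 <= k <oo) (H k `^ r)%:E)%E.
  apply: le_trans (nneseries_lim_ge k.+1 _) => //.
  by rewrite big_nat_recr//= leeDr// sume_ge0.
rewrite gt0_ler_poweR ?in_itv/= ?leey ?andbT ?Hr// ?invr_ge0 ?(ltW r0)//.
exact: le_trans HS.
Qed.

Lemma seq_norm_conv H E w W :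
  (forall k, 0 <= H k) -> (forall k, 0 <= E k) -> (forall k, 0 <= w k) ->
  (forall m, \sum_(i < m) w i <= W) ->
  (forall k, H k <= \sum_(j < k.+1) w (k - j)%N * E j) ->
  (seq_norm q E < +oo)%E ->
  (seq_norm q H <= W%:E * seq_norm q E)%E.
Proof.
move=> H0 E0 w0 wW HE Efin.
have W0 : 0 <= W by have := wW 0%N; rewrite big_ord0.
move: (fun k => le_seq_norm k E0) (seq_norm_ge0 E0) Efin.
case: q q1 => [r||//] r1 /=; last first.
  set M := ereal_sup _ => EM M0 Mfin.
  have Mnum : M \is a fin_num by rewrite ge0_fin_numE.
  apply: ge_ereal_sup => _ [k _ <-]; rewrite -(fineK Mnum) -EFinM lee_fin.
  apply: le_trans (HE k) _.
  apply: (@le_trans _ _ (\sum_(j < k.+1) w (k - j)%N * fine M)).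
    apply: ler_sum => j _; rewrite ler_wpM2l// -lee_fin fineK//.
  rewrite -mulr_suml ler_wpM2r ?fine_ge0//; apply: le_trans (wW k.+1).
  rewrite (reindex_inj rev_ord_inj)/=; apply: ler_sum => j _.
  by rewrite subSS subKn// -ltnS.
rewrite lee_fin in r1; have r0 : 0 < r by rewrite (lt_le_trans _ r1).
set S := (\sum_(0 <= k <oo) (E k `^ r)%:E)%E => _ _ Sfin.
have Er i : (0 <= (E i `^ r)%:E)%E by rewrite lee_fin powR_ge0.
have Hr i : (0 <= (H i `^ r)%:E)%E by rewrite lee_fin powR_ge0.
have S0 : (0 <= S)%E by apply: nneseries_ge0.
have Snum : S \is a fin_num.
  by rewrite ge0_fin_numE//; apply: lty_poweRy Sfin; rewrite invr_neq0 ?gt_eqF.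
have key : (\sum_(0 <= k <oo) (H k `^ r)%:E <= (W `^ r * fine S)%:E)%E.
  apply: nneseries_le => // n; rewrite big_mkord sumEFin lee_fin.
  apply: le_trans (sum_powR_conv n r1 H0 E0 w0 wW HE) _.
  rewrite ler_wpM2l ?powR_ge0// -lee_fin fineK// -sumEFin.
  rewrite -(big_mkord xpredT (fun k => (E k `^ r)%:E)).
  by apply: nneseries_lim_ge.
have -> : (W%:E * S `^ r^-1 = (W `^ r * fine S)%:E `^ r^-1)%E.
  rewrite -{1}(fineK Snum) !poweR_EFin powRM ?powR_ge0 ?fine_ge0//.
  by rewrite -powRrM divff ?gt_eqF// powRr1// EFinM.
rewrite gt0_ler_poweR ?in_itv/= ?leey ?andbT ?nneseries_ge0 ?invr_ge0 ?(ltW r0)//.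
by rewrite lee_fin mulr_ge0 ?powR_ge0 ?fine_ge0.
Qed.

End seq_norm.

(** * Complex-valued functions *)

Section cabs.
Context (R : realType).
Implicit Types z w : R[i].

Lemma cabs_ge0 z : 0 <= cabs z.
Proof. by case: z => a b; exact: sqrtr_ge0. Qed.

Lemma cabs0 : cabs (0 : R[i]) = 0.
Proof. exact: ComplexField.Normc.normc0. Qed.

Lemma cabsM z w : cabs (z * w) = cabs z * cabs w.
Proof. exact: ComplexField.Normc.normcM. Qed.

Lemma cabsN z : cabs (- z) = cabs z.
Proof. by case: z => a b; rewrite /= !sqrrN. Qed.

Lemma cabsD z w : cabs (z + w) <= cabs z + cabs w.
Proof. exact: le_normcD. Qed.

Lemma cabsB z w : cabs (z - w) <= cabs z + cabs w.
Proof. by rewrite -[cabs w]cabsN; exact: cabsD. Qed.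

Lemma cabs_sum (I : Type) (r : seq I) (F : I -> R[i]) :
  cabs (\sum_(i <- r) F i) <= \sum_(i <- r) cabs (F i).
Proof.
elim: r => [|i r IH]; first by rewrite !big_nil cabs0.
by rewrite !big_cons (le_trans (cabsD _ _))// lerD2l.
Qed.

Lemma cabs_real (x : R) : cabs (x%:C)%C = `|x|.
Proof. by rewrite /= expr0n/= addr0 sqrtr_sqr. Qed.

Lemma cabs_Re z : `|complex.Re z| <= cabs z.
Proof.
by case: z => a b /=; rewrite -sqrtr_sqr ler_wsqrtr// lerDl sqr_ge0.
Qed.

Lemma cabs_Im z : `|complex.Im z| <= cabs z.
Proof.
by case: z => a b /=; rewrite -sqrtr_sqr ler_wsqrtr// lerDr sqr_ge0.
Qed.

Lemma cabs_sqr z : cabs z ^+ 2 = complex.Re z ^+ 2 + complex.Im z ^+ 2.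
Proof. by case: z => a b /=; rewrite sqr_sqrtr// addr_ge0 ?sqr_ge0. Qed.

Lemma cabs_cauchy_schwarz z w :
  complex.Re z * complex.Re w + complex.Im z * complex.Im w <= cabs z * cabs w.
Proof.
rewrite -cabsM; apply: le_trans (ler_norm _) _.
(* The left side is the real part of the conjugate of [z] times [w]. *)
have -> : complex.Re z * complex.Re w + complex.Im z * complex.Im w =
    complex.Re ((complex.Re z -i* complex.Im z)%C * w).
  by case: z w => a b [c e] /=; rewrite mulNr opprK.
apply: le_trans (cabs_Re _) _; rewrite !cabsM.
by case: z => a b /=; rewrite sqrrN.
Qed.

End cabs.

Section cmeasurable.
Context (R : realType) (d : measure_display) (T : measurableType d).
Implicit Types u v : T -> R[i].

Lemma measurable_cabs u : cmeasurable u ->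
  measurable_fun setT (fun x => cabs (u x)).
Proof.
move=> [mr mi].
rewrite (_ : (fun x => _) = fun x =>
    (complex.Re (u x) ^+ 2 + complex.Im (u x) ^+ 2) `^ 2^-1); last first.
  by apply/funext => x; rewrite powR12_sqrt ?addr_ge0 ?sqr_ge0//; case: (u x).
apply: (measurableT_comp (measurable_powR _)).
by apply: measurable_funD; exact: measurable_funX.
Qed.

Lemma measurable_cabs_powR u (p : R) : cmeasurable u ->
  measurable_fun setT (fun x => (cabs (u x) `^ p)%:E).
Proof.
move=> mu; apply/measurable_EFinP.
exact: (measurableT_comp (measurable_powR _) (measurable_cabs mu)).
Qed.

Lemma cmeasurable_cst (z : R[i]) : cmeasurable (fun _ : T => z).
Proof. by split; exact: measurable_cst. Qed.

Lemma cmeasurableD u v : cmeasurable u -> cmeasurable v ->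
  cmeasurable (fun x => u x + v x).
Proof.
move=> [ur ui] [vr vi]; split.
- rewrite (_ : (fun x => _) = (fun x => complex.Re (u x) + complex.Re (v x))).
    exact: measurable_funD.
  by apply/funext => x; case: (u x) (v x) => ? ? [].
- rewrite (_ : (fun x => _) = (fun x => complex.Im (u x) + complex.Im (v x))).
    exact: measurable_funD.
  by apply/funext => x; case: (u x) (v x) => ? ? [].
Qed.

Lemma cmeasurableM u v : cmeasurable u -> cmeasurable v ->
  cmeasurable (fun x => u x * v x).
Proof.
move=> [ur ui] [vr vi]; split.
- rewrite (_ : (fun x => _) = (fun x => complex.Re (u x) * complex.Re (v x)
     - complex.Im (u x) * complex.Im (v x))).
    by apply: measurable_funB; exact: measurable_funM.
  by apply/funext => x; case: (u x) (v x) => ? ? [].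
- rewrite (_ : (fun x => _) = (fun x => complex.Re (u x) * complex.Im (v x)
     + complex.Im (u x) * complex.Re (v x))).
    by apply: measurable_funD; exact: measurable_funM.
  by apply/funext => x; case: (u x) (v x) => ? ? [].
Qed.

Lemma cmeasurableB u v : cmeasurable u -> cmeasurable v ->
  cmeasurable (fun x => u x - v x).
Proof.
move=> mu mv; rewrite (_ : (fun x => _) = (fun x => u x + (-1) * v x)).
  by apply: cmeasurableD => //; apply: cmeasurableM => //; exact: cmeasurable_cst.
by apply/funext => x; rewrite mulN1r.
Qed.

Lemma cmeasurable_sum (I : Type) (r : seq I) (u : I -> T -> R[i]) :
  (forall i, cmeasurable (u i)) -> cmeasurable (fun x => \sum_(i <- r) u i x).
Proof.
move=> mu; elim: r => [|i r IH].
  rewrite (_ : (fun x => _) = fun=> 0); first exact: cmeasurable_cst.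
  by apply/funext => x; rewrite big_nil.
rewrite (_ : (fun x => _) = fun x => u i x + \sum_(i <- r) u i x).
  exact: cmeasurableD.
by apply/funext => x; rewrite big_cons.
Qed.

Lemma cmeasurable_indic (A : set T) : measurable A ->
  cmeasurable (fun x => ((\1_A x : R)%:C)%C).
Proof.
by move=> mA; split; [exact: measurable_indic|exact: measurable_cst].
Qed.

End cmeasurable.

(** * L^p norms of complex functions on a finite measure space *)

Section cLnorm.
Context (R : realType) (d : measure_display) (T : measurableType d).
Context (mu : {finite_measure set T -> \bar R}) (p : R).
Hypothesis p1 : 1 <= p.
Implicit Types u v : T -> R[i].

Let p0 : 0 < p. Proof. by rewrite (lt_le_trans _ p1). Qed.

Lemma cLnormE u : (cLnorm mu p%:E u =
  (\int[mu]_x (cabs (u x) `^ p)%:E) `^ p^-1)%E.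
Proof.
rewrite /cLnorm unlock; apply: (congr1 (fun z => z `^ p^-1)%E).
apply: eq_integral => x _.
by rewrite /= ger0_norm// cabs_ge0.
Qed.

Lemma cLnorm_ge0 u : (0 <= cLnorm mu p%:E u)%E.
Proof. exact: Lnorm_ge0. Qed.

Lemma cLnorm_le u v (c : R) : cmeasurable u -> cmeasurable v -> 0 <= c ->
  {ae mu, forall x, cabs (u x) <= c * cabs (v x)} ->
  (cLnorm mu p%:E u <= c%:E * cLnorm mu p%:E v)%E.
Proof.
move=> mu_ mv c0 uv; rewrite !cLnormE.
have pi0 : 0 <= p^-1 by rewrite invr_ge0 ltW.
have ge0 (w : T -> R[i]) x : (0 <= (cabs (w x) `^ p)%:E)%E.
  by rewrite lee_fin powR_ge0.
have -> : (c%:E * (\int[mu]_x (cabs (v x) `^ p)%:E) `^ p^-1 =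
    (\int[mu]_x ((c `^ p)%:E * (cabs (v x) `^ p)%:E)) `^ p^-1)%E.
  rewrite ge0_integralZl//; last 2 first.
  - exact: measurable_cabs_powR.
  - by rewrite lee_fin powR_ge0.
  rewrite poweRM ?lee_fin ?powR_ge0 ?integral_ge0//.
  by rewrite poweR_EFin -powRrM divff ?gt_eqF// powRr1.
have le : (\int[mu]_x (cabs (u x) `^ p)%:E <=
    \int[mu]_x ((c `^ p)%:E * (cabs (v x) `^ p)%:E))%E.
  apply: ae_ge0_le_integral => //.
  - exact: measurable_cabs_powR.
  - by move=> x _; rewrite mule_ge0 ?lee_fin ?powR_ge0.
  - by apply: measurable_funeM; exact: measurable_cabs_powR.
  - apply: filterS uv => x uv _; rewrite -EFinM lee_fin -powRM ?cabs_ge0//.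
    by rewrite ge0_ler_powR ?nnegrE ?cabs_ge0 ?mulr_ge0 ?cabs_ge0 ?(ltW p0).
rewrite gt0_ler_poweR// in_itv/= leey andbT integral_ge0// => x _.
by rewrite mule_ge0 ?lee_fin ?powR_ge0.
Qed.

Lemma cLnorm_ae_eq u v : cmeasurable u -> cmeasurable v ->
  {ae mu, forall x, u x = v x} -> cLnorm mu p%:E u = cLnorm mu p%:E v.
Proof.
move=> mu_ mv uv; apply/eqP; rewrite eq_le; apply/andP; split.
- by rewrite -[leRHS]mul1e cLnorm_le//; apply: filterS uv => x ->; rewrite mul1r.
- by rewrite -[leRHS]mul1e cLnorm_le//; apply: filterS uv => x ->; rewrite mul1r.
Qed.

Lemma cLnormD u v : cmeasurable u -> cmeasurable v ->
  (cLnorm mu p%:E (fun x => (u x + v x)%R) <=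
   cLnorm mu p%:E u + cLnorm mu p%:E v)%E.
Proof.
move=> mu_ mv; have := @minkowski_EFin _ _ _ mu (fun x => cabs (u x))
  (fun x => cabs (v x)) p (measurable_cabs mu_) (measurable_cabs mv) p1.
apply: le_trans.
have -> : Lnorm mu p%:E (EFin \o ((fun x => cabs (u x)) \+ (fun x => cabs (v x)))) =
    cLnorm mu p%:E (fun x => ((cabs (u x) + cabs (v x))%:C)%C).
  apply: eq_Lnorm => x /=; rewrite -[Num.sqrt _]/(cabs ((cabs (u x) + cabs (v x))%:C)%C).
  by rewrite cabs_real ger0_norm// addr_ge0 ?cabs_ge0.
rewrite -[leRHS]mul1e cLnorm_le//.
- exact: cmeasurableD.
- by split; [apply: measurable_funD; exact: measurable_cabs|exact: measurable_cst].
- apply: aeW => x; rewrite mul1r cabs_real.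
  by rewrite (le_trans (cabsD _ _))// ler_norm.
Qed.

(** Hölder against the constant 1, with [p = 1] apart because the conjugate exponent is then
    infinite. Averages over cells see L^1 convergence, whereas representations converge in L^p. *)
Lemma cLnorm_L1 : exists2 C : R, 0 <= C & forall u, cmeasurable u ->
  (\int[mu]_x (cabs (u x))%:E <= C%:E * cLnorm mu p%:E u)%E.
Proof.
have L1 u : (\int[mu]_x (cabs (u x))%:E = cLnorm mu 1%:E u)%E.
  by rewrite /cLnorm Lnorm1; apply: eq_integral => x _;
    rewrite gee0_abs// lee_fin cabs_ge0.
move: p1; rewrite le_eqVlt => /predU1P[<-|lt1p].
  by exists 1 => // u _; rewrite L1 mul1e.
pose q := p / (p - 1).
have q0 : 0 < q by rewrite divr_gt0// subr_gt0.
have pq : p^-1 + q^-1 = 1 by rewrite /q; field; lra.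
have muT : (mu setT `^ q^-1)%E \is a fin_num by rewrite fin_num_poweR ?fin_num_measure.
exists (fine (mu setT `^ q^-1)%E); first by rewrite fine_ge0 ?poweR_ge0.
move=> u mu_; have := @hoelder _ _ _ mu (fun x => cabs (u x)) (cst 1) p q
  (measurable_cabs mu_) (measurable_cst _) p0 q0 pq.
rewrite (_ : EFin \o cst 1 = cst 1%E)// Lnorm_cst1 (fineK muT) muleC; apply: le_trans.
rewrite L1 le_eqVlt; apply/orP; left; apply/eqP.
by apply: eq_Lnorm => x /=; rewrite mulr1.
Qed.

Lemma cvge0_nnegP (u : nat -> \bar R) : (forall n, 0 <= u n)%E ->
  u n @[n --> \oo] --> 0%E <->
  (forall e, 0 < e -> \forall n \near \oo, (u n <= e%:E)%E).
Proof.
move=> u0; split=> [cu e e0|ue].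
  have [/= ufin] := (fine_cvgP _ _).1 cu.
  move/cvgr0Pnorm_lt => /(_ e e0) ce; near=> n.
  have un : u n \is a fin_num by near: n.
  rewrite -(fineK un) lee_fin; apply: ltW; apply: le_lt_trans (ler_norm _) _.
  by near: n.
apply/fine_cvgP; split.
  have := ue 1 ltr01; apply: filterS => n un.
  by rewrite ge0_fin_numE// (le_lt_trans un)// ltry.
apply/cvgr0Pnorm_le => e e0; have := ue e e0; apply: filterS => n un /=.
have unf : u n \is a fin_num by rewrite ge0_fin_numE// (le_lt_trans un)// ltry.
by rewrite ger0_norm ?fine_ge0// -lee_fin fineK.
Unshelve. all: by end_near. Qed.

(** Since [|u|^p <= M^(p-1) |u|], a uniform bound upgrades L^1 convergence to L^p convergence. *)
Lemma cLnorm_bounded_cvg0 (u : nat -> T -> R[i]) (M : R) : 0 <= M ->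
  (forall n, cmeasurable (u n)) ->
  (forall n, {ae mu, forall x, cabs (u n x) <= M}) ->
  (\int[mu]_x (cabs (u n x))%:E)%E @[n --> \oo] --> 0%E ->
  cLnorm mu p%:E (u n) @[n --> \oo] --> 0%E.
Proof.
move=> M0 mu_ uM; have ge0 n : (0 <= \int[mu]_x (cabs (u n x))%:E)%E.
  by apply: integral_ge0 => x _; rewrite lee_fin cabs_ge0.
move/(cvge0_nnegP ge0) => cu; apply/cvge0_nnegP.
  by move=> n; exact: cLnorm_ge0.
move=> e e0.
(* The [+ 1] keeps [K] invertible when [M = 0]. *)
pose K := M `^ (p - 1) + 1.
have K0 : 0 < K by rewrite ltr_wpDl ?powR_ge0.
have := cu (e `^ p / K) (divr_gt0 (powR_gt0 _ e0) K0).
apply: filterS => n un; rewrite cLnormE.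
have -> : e%:E = ((e `^ p)%:E `^ p^-1)%E.
  by rewrite poweR_EFin -powRrM divff ?gt_eqF// powRr1// ltW.
have le : (\int[mu]_x (cabs (u n x) `^ p)%:E <= (e `^ p)%:E)%E.
  have -> : ((e `^ p)%:E = K%:E * (e `^ p / K)%:E)%E.
    by rewrite -EFinM mulrC divfK// lt0r_neq0.
  apply: le_trans (lee_wpmul2l _ un); last by rewrite lee_fin ltW.
  rewrite -ge0_integralZl//; last 3 first.
  - by apply/measurable_EFinP; exact: measurable_cabs.
  - by move=> x _; rewrite lee_fin cabs_ge0.
  - by rewrite lee_fin ltW.
  apply: ae_ge0_le_integral => //.
  - by move=> x _; rewrite lee_fin powR_ge0.
  - exact: measurable_cabs_powR.
  - by move=> x _; rewrite -EFinM lee_fin mulr_ge0 ?cabs_ge0// ltW.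
  - by apply: measurable_funeM; apply/measurable_EFinP; exact: measurable_cabs.
  - apply: filterS (uM n) => x uMx _; rewrite -EFinM lee_fin.
    rewrite -(mulr_powRB1 (cabs_ge0 _) p0) mulrC ler_wpM2r ?cabs_ge0//.
    apply: (@le_trans _ _ (M `^ (p - 1))); last by rewrite lerDl.
    by rewrite ge0_ler_powR ?nnegrE ?cabs_ge0// subr_ge0.
rewrite gt0_ler_poweR ?invr_ge0 ?(ltW p0)// in_itv/= leey andbT.
  by apply: integral_ge0 => x _; rewrite lee_fin powR_ge0.
by rewrite lee_fin powR_ge0.
Qed.

End cLnorm.

(** * Integrals of complex functions over measurable sets *)

Section complex_integral.
Context (R : realType) (d : measure_display) (T : measurableType d).
Context (mu : {finite_measure set T -> \bar R}).
Implicit Types (u v w : T -> R[i]) (W : set T).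

Definition cL1 u := cmeasurable u /\ (\int[mu]_x (cabs (u x))%:E < +oo)%E.

Definition cint W u : R[i] :=
  Complex (\int[mu]_(x in W) complex.Re (u x)) (\int[mu]_(x in W) complex.Im (u x)).

Definition absint W u : R := \int[mu]_(x in W) cabs (u x).

Lemma cL1_integrable W u : measurable W -> cL1 u ->
  [/\ mu.-integrable W (EFin \o (fun x => cabs (u x))),
      mu.-integrable W (EFin \o (fun x => complex.Re (u x))) &
      mu.-integrable W (EFin \o (fun x => complex.Im (u x)))].
Proof.
move=> mW [mu_ ufin]; have [mr mi] := mu_; have mc := measurable_cabs mu_.
have iT : mu.-integrable setT (EFin \o (fun x => cabs (u x))).
  apply/integrableP; split; first exact/measurable_EFinP.
  apply: le_lt_trans ufin; apply: ge0_le_integral => //.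
  - by apply: measurableT_comp => //; exact/measurable_EFinP.
  - exact/measurable_EFinP.
  - by move=> x _; rewrite /= ger0_norm ?cabs_ge0.
have iW (f : T -> R) : measurable_fun setT f -> (forall x, `|f x| <= cabs (u x)) ->
    mu.-integrable W (EFin \o f).
  move=> mf fu; apply: (@integrableS _ _ _ mu setT) => //.
  apply: (le_integrable _ _ _ iT) => //; first exact/measurable_EFinP.
  by move=> x _ /=; rewrite lee_fin (ger0_norm (cabs_ge0 _)).
split; apply: iW => // x; first by rewrite ger0_norm ?cabs_ge0.
- exact: cabs_Re.
- exact: cabs_Im.
Qed.

Lemma absintE W u : measurable W -> cL1 u ->
  (absint W u)%:E = (\int[mu]_(x in W) (cabs (u x))%:E)%E.
Proof.
move=> mW /(cL1_integrable mW)[iu _ _].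
by rewrite /absint /Rintegral fineK// integrable_fin_num.
Qed.

Lemma absint_ge0 W u : 0 <= absint W u.
Proof. by apply: Rintegral_ge0 => x _; exact: cabs_ge0. Qed.

(* Test the vector [cint W u] against itself and use Cauchy-Schwarz under the
   integral. *)
Lemma cabs_cint W u : measurable W -> cL1 u -> cabs (cint W u) <= absint W u.
Proof.
move=> mW Lu; have [iu ir ii] := cL1_integrable mW Lu.
set z := cint W u; have [->|z0] := eqVneq (cabs z) 0; first exact: absint_ge0.
have zpos : 0 < cabs z by rewrite lt_neqAle eq_sym z0 cabs_ge0.
suff : cabs z * cabs z <= cabs z * absint W u by rewrite ler_pM2l.
have ir' : mu.-integrable W (EFin \o (fun x => complex.Re z * complex.Re (u x))).
  exact: (integrableZl mW (complex.Re z) ir).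
have ii' : mu.-integrable W (EFin \o (fun x => complex.Im z * complex.Im (u x))).
  exact: (integrableZl mW (complex.Im z) ii).
have -> : cabs z * cabs z = \int[mu]_(x in W) (complex.Re z * complex.Re (u x) +
    complex.Im z * complex.Im (u x)).
  rewrite RintegralD//.
  by rewrite !RintegralZl// -expr2 cabs_sqr.
rewrite /absint -RintegralZl//; apply: le_Rintegral => //.
- exact: (integrableD mW ir' ii').
- exact: (integrableZl mW (cabs z) iu).
- by move=> x _; exact: cabs_cauchy_schwarz.
Qed.

Lemma cintB W u v : measurable W -> cL1 u -> cL1 v ->
  cint W (fun x => u x - v x) = cint W u - cint W v.
Proof.
move=> mW Lu Lv; have [_ ur ui] := cL1_integrable mW Lu.
have [_ vr vi] := cL1_integrable mW Lv.
rewrite /cint (_ : (fun x => complex.Re _) =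
    fun x => complex.Re (u x) - complex.Re (v x)); last first.
  by apply/funext => x; case: (u x) (v x) => ? ? [].
rewrite (_ : (fun x => complex.Im _) =
    fun x => complex.Im (u x) - complex.Im (v x)); last first.
  by apply/funext => x; case: (u x) (v x) => ? ? [].
by rewrite !RintegralB.
Qed.

Lemma cint_cst W u z : measurable W -> (forall x, W x -> u x = z) ->
  cint W u = z * ((fine (mu W))%:C)%C.
Proof.
move=> mW uz; rewrite /cint.
rewrite (@eq_Rintegral _ _ _ mu W (fun=> complex.Re z)
  (fun x => complex.Re (u x))); last first.
  by move=> x; rewrite inE => Wx; rewrite uz.
rewrite (@eq_Rintegral _ _ _ mu W (fun=> complex.Im z)
  (fun x => complex.Im (u x))); last first.
  by move=> x; rewrite inE => Wx; rewrite uz.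
rewrite !Rintegral_cst//; case: (z) => a b /=.
by congr Complex; rewrite mulr0 ?subr0 ?add0r.
Qed.

Lemma absint_ae_le W u (M : R) : measurable W -> cL1 u -> 0 <= M ->
  {ae mu, forall x, cabs (u x) <= M} -> absint W u <= M * fine (mu W).
Proof.
move=> mW Lu M0 uM; rewrite -lee_fin absintE// EFinM fineK ?fin_num_measure//.
rewrite -integral_cst//; apply: ae_ge0_le_integral => //.
- by move=> x _; rewrite lee_fin cabs_ge0.
- apply: (@measurable_funS _ _ _ _ setT) => //.
  by apply/measurable_EFinP; apply: measurable_cabs; case: Lu.
- by apply: filterS uM => x uM _; rewrite lee_fin.
Qed.

Lemma absint_le3 W u v w : measurable W -> cL1 u -> cL1 v -> cL1 w ->
  (forall x, W x -> cabs (u x) <= cabs (v x) + cabs (w x)) ->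
  absint W u <= absint W v + absint W w.
Proof.
move=> mW Lu Lv Lw uvw.
have [iu _ _] := cL1_integrable mW Lu.
have [iv _ _] := cL1_integrable mW Lv.
have [iw _ _] := cL1_integrable mW Lw.
rewrite /absint -RintegralD//; apply: le_Rintegral => //.
exact: (integrableD mW iv iw).
Qed.

Lemma absint_subset W W' u : measurable W -> measurable W' -> cL1 u ->
  W `<=` W' -> absint W u <= absint W' u.
Proof.
move=> mW mW' Lu WW'; rewrite -lee_fin !absintE//.
apply: ge0_subset_integral => //.
  apply: (@measurable_funS _ _ _ _ setT) => //.
  by apply/measurable_EFinP; apply: measurable_cabs; case: Lu.
by move=> x _; rewrite lee_fin cabs_ge0.
Qed.

Lemma cL1D u v : cL1 u -> cL1 v -> cL1 (fun x => u x + v x).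
Proof.
move=> [mu_ fu] [mv fv]; split; first exact: cmeasurableD.
apply: (@le_lt_trans _ _ (\int[mu]_x ((cabs (u x))%:E + (cabs (v x))%:E))%E).
  apply: ge0_le_integral => //.
  - by move=> x _; rewrite lee_fin cabs_ge0.
  - by apply/measurable_EFinP/measurable_cabs; exact: cmeasurableD.
  - apply: emeasurable_funD; exact/measurable_EFinP/measurable_cabs.
  - by move=> x _; rewrite -EFinD lee_fin cabsD.
rewrite ge0_integralD//; first exact: lte_add_pinfty.
- by move=> x _; rewrite lee_fin cabs_ge0.
- exact/measurable_EFinP/measurable_cabs.
- by move=> x _; rewrite lee_fin cabs_ge0.
- exact/measurable_EFinP/measurable_cabs.
Qed.

Lemma cL1N u : cL1 u -> cL1 (fun x => - u x).
Proof.
move=> [mu_ fu]; split.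
  rewrite (_ : (fun x => _) = fun x => (-1) * u x).
    by apply: cmeasurableM => //; exact: cmeasurable_cst.
  by apply/funext => x; rewrite mulN1r.
by apply: le_lt_trans fu; under eq_integral do rewrite cabsN.
Qed.

Lemma cL1B u v : cL1 u -> cL1 v -> cL1 (fun x => u x - v x).
Proof. by move=> Lu Lv; apply: cL1D => //; exact: cL1N. Qed.

Lemma cL1_bounded u (M : R) : cmeasurable u -> (forall x, cabs (u x) <= M) -> cL1 u.
Proof.
move=> mu_ uM; split => //.
apply: (@le_lt_trans _ _ (\int[mu]_x (cst M%:E x))%E).
  apply: ge0_le_integral => //.
  - by move=> x _; rewrite lee_fin cabs_ge0.
  - exact/measurable_EFinP/measurable_cabs.
  - by move=> x _; rewrite lee_fin.
by rewrite integral_cst// ltey_eq fin_numM// fin_num_measure.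
Qed.

Lemma cL1_sum (I : Type) (r : seq I) (u : I -> T -> R[i]) :
  (forall i, cL1 (u i)) -> cL1 (fun x => \sum_(i <- r) u i x).
Proof.
move=> Lu; elim: r => [|i r IH].
  apply: (@cL1_bounded _ 0) => [|x]; last by rewrite big_nil cabs0.
  exact: (cmeasurable_sum [::] (fun i => proj1 (Lu i))).
rewrite (_ : (fun x => _) = fun x => u i x + \sum_(i <- r) u i x).
  exact: cL1D.
by apply/funext => x; rewrite big_cons.
Qed.

Lemma absint_sum (I : Type) (r : seq I) W (u : I -> T -> R[i]) :
  measurable W -> (forall i, cL1 (u i)) ->
  absint W (fun x => \sum_(i <- r) u i x) <= \sum_(i <- r) absint W (u i).
Proof.
move=> mW Lu; elim: r => [|i r IH].
  rewrite big_nil /absint (@eq_Rintegral _ _ _ mu W (fun=> 0)).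
    by rewrite Rintegral_cst// mul0r.
  by move=> x _; rewrite big_nil cabs0.
rewrite big_cons; apply: le_trans (lerD (lexx _) IH).
apply: absint_le3 => //; try exact: cL1_sum.
by move=> x _; rewrite big_cons cabsD.
Qed.

End complex_integral.

(** * Cells of a good grid *)

Definition cells (T : Type) (P : nat -> set (set T)) (k : nat) : seq (set T) :=
  finmap.enum_fset (fset_set (P k)).

Section grid.
Context (R : realType) (d : measure_display) (T : measurableType d).
Context (mu : {finite_measure set T -> \bar R}) (l1 l2 : R) (P : nat -> set (set T)).
Hypothesis gg : good_grid mu l1 l2 P.
Implicit Types (Q W : set T) (u v : T -> R[i]).

Local Notation m Q := (fine (mu Q)).

Lemma l1_gt0 : 0 < l1. Proof. by case: gg => -[]. Qed.

Lemma l2_gt0 : 0 < l2.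
Proof. by case: gg => -[l10 l12 _] _; exact: lt_trans l12. Qed.

Lemma l2_lt1 : l2 < 1. Proof. by case: gg => -[]. Qed.

Lemma l2_powR_lt1 t : 0 < t -> l2 `^ t < 1.
Proof.
move=> t0; have : l2 `^ t < 1 `^ t.
  by rewrite gt0_ltr_powR ?nnegrE ?ler01 ?(ltW l2_gt0) ?l2_lt1.
by rewrite powR1.
Qed.

Lemma finite_cells k : finite_set (P k).
Proof. by case: gg => _ [[]]. Qed.

Lemma cellsP k Q : reflect (P k Q) (Q \in cells P k).
Proof.
have -> : (Q \in cells P k) = (Q \in P k) := in_fset_set (finite_cells k) Q.
by apply: (iffP idP); rewrite inE.
Qed.

Lemma cells_uniq k : uniq (cells P k).
Proof. exact: finmap.fset_uniq. Qed.

Lemma measurable_cell k Q : P k Q -> measurable Q.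
Proof. by case: gg => _ [[_ mP _] _] /mP[]. Qed.

Lemma cell_gt0 k Q : P k Q -> 0 < m Q.
Proof.
case: gg => _ [[_ mP _] _] /mP[mQ Q0].
by rewrite fine_gt0// Q0 ltey_eq fin_num_measure.
Qed.

Lemma cell_nonempty k Q : P k Q -> exists x, Q x.
Proof.
move=> PQ; have [Q0|/set0P//] := eqVneq Q set0.
by have := cell_gt0 PQ; rewrite Q0 measure0 ltxx.
Qed.

Lemma cell_eq k Q Q' x : P k Q -> P k Q' -> Q x -> Q' x -> Q = Q'.
Proof.
case: gg => _ [_ [_ disj _ _ _]] PQ PQ' Qx Q'x.
apply: contrapT => /(disj k _ _ PQ PQ') QQ'0.
by have : (Q `&` Q') x by []; rewrite QQ'0.
Qed.

Lemma cell_ratio k Q Q' : P k.+1 Q -> P k Q' -> Q `<=` Q' ->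
  l1 * m Q' <= m Q <= l2 * m Q'.
Proof.
case: gg => _ [_ [_ _ _ ratio _]] PQ PQ' QQ'.
have := ratio k Q Q' PQ PQ' QQ'.
by rewrite ler_pdivlMr ?ler_pdivrMr// (cell_gt0 PQ').
Qed.

Lemma cell_ancestor k j Q : P (k + j)%N Q ->
  exists2 Q', P k Q' & Q `<=` Q' /\ m Q <= l2 ^+ j * m Q'.
Proof.
elim: j Q => [|j IH] Q.
  by rewrite addn0 => PQ; exists Q => //; split=> //; rewrite expr0 mul1r.
rewrite addnS => PQ; have [_ [_ [_ _ par _ _]]] := gg.
have [Q1 PQ1 QQ1] := par _ _ PQ.
have [Q2 PQ2 [Q12 m12]] := IH _ PQ1.
exists Q2 => //; split; first exact: subset_trans Q12.
have /andP[_ mQ] := cell_ratio PQ PQ1 QQ1.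
by apply: le_trans mQ _; rewrite exprS -mulrA ler_wpM2l// (ltW l2_gt0).
Qed.

(** A set that is a cell at two levels would be its own ancestor, so its positive measure would be
    at most a proper fraction of itself. *)
Lemma cell_level j k Q : P j Q -> P k Q -> j = k.
Proof.
have lt i : forall j, P i Q -> P (i + j.+1)%N Q -> False.
  move=> {}j Pi Pj; have [Q' PQ' [QQ' mQ]] := cell_ancestor Pj.
  have [x Qx] := cell_nonempty Pi.
  rewrite -(cell_eq Pi PQ' Qx (QQ' _ Qx)) in mQ.
  have : l2 ^+ j.+1 < 1 by rewrite exprn_ilt1 ?l2_lt1// ltW// l2_gt0.
  move=> l21; have mQ0 := cell_gt0 Pi.
  suff : m Q < m Q by rewrite ltxx.
  by apply: le_lt_trans mQ _; rewrite gtr_pMl.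
move=> Pj Pk; case: (ltngtP j k) => // [jk|kj]; exfalso.
- by apply: (lt j (k - j.+1)%N) => //; rewrite addnS -addSn subnKC.
- by apply: (lt k (j - k.+1)%N) => //; rewrite addnS -addSn subnKC.
Qed.

Lemma cell_T : P 0%N setT.
Proof. by case: gg => _ [[_ _ ->] _]. Qed.

Lemma cell_measure_le k Q : P k Q -> m Q <= l2 ^+ k * m setT.
Proof.
move=> PQ; have [Q' PQ' [_ mQ]] := @cell_ancestor 0 k Q PQ.
have [x Q'x] := cell_nonempty PQ'.
by rewrite (cell_eq cell_T PQ' (I : setT x) Q'x).
Qed.

Lemma ae_cell : {ae mu, forall x, forall k, exists2 Q, P k Q & Q x}.
Proof.
apply: ae_foralln => k; case: gg => _ [[_ mP _] [cov _ _ _ _]].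
exists (~` \bigcup_(Q in P k) Q); split.
- apply: measurableC; apply: fin_bigcup_measurable; first exact: finite_cells.
  by move=> Q /mP[].
- exact: cov.
- by move=> x /= nx [Q PQ Qx]; apply: nx; exists Q.
Qed.

(** What remains of an atom when its size is forgotten. It covers the given atoms, the indicators
    that carry the averages, and the atoms of the product. *)
Definition grid_step k (a : set T -> T -> R[i]) :=
  forall Q, P k Q -> exists z : R[i], forall x, a Q x = z * ((\1_Q x : R)%:C)%C.

Lemma block_in c a k Q x : grid_step k a -> P k Q -> Q x ->
  block P c a k x = c Q * a Q x.
Proof.
move=> step PQ Qx; rewrite /block (fsbigD1 Q)//=; last exact: finite_cells.
rewrite fsbig1 ?addr0// => W [PW WQ]; have [z ->] := step _ PW.
rewrite indicE memNset ?mulr0// => Wx; apply: WQ.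
by rewrite /= (cell_eq PW PQ Wx Qx).
Qed.

Lemma block_out c a k x : grid_step k a -> (forall Q, P k Q -> ~ Q x) ->
  block P c a k x = 0.
Proof.
move=> step out; rewrite /block fsbig1// => W PW; have [z ->] := step _ PW.
by rewrite indicE memNset ?mulr0//; exact: out.
Qed.

Lemma cmeasurable_block c a k : grid_step k a -> cmeasurable (block P c a k).
Proof.
move=> step.
(* Nothing is known about [a Q] when [Q] is not a cell of level [k]; the guard makes every term
   measurable, as [cmeasurable_sum] asks. *)
rewrite (_ : block P c a k = fun x => \sum_(Q <- cells P k)
   (if Q \in cells P k then c Q * a Q x else 0)); last first.
  apply/funext => x; rewrite /block (fsbig_finite _ _ (finite_cells k)).
  by apply: eq_big_seq => Q cQ; rewrite ifT.
apply: cmeasurable_sum => Q.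
case: (boolP (Q \in cells P k)) => [/cellsP PQ|_]; last exact: cmeasurable_cst.
have [z az] := step _ PQ.
rewrite (_ : (fun x => _) = fun x => (c Q * z) * ((\1_Q x : R)%:C)%C).
  apply: cmeasurableM; first exact: cmeasurable_cst.
  exact/cmeasurable_indic/(measurable_cell PQ).
by apply/funext => x; rewrite az mulrA.
Qed.

Definition cell_constant k u :=
  forall Q x y, P k Q -> Q x -> Q y -> u x = u y.

Lemma cell_constant_ge k j u : (k <= j)%N -> cell_constant k u -> cell_constant j u.
Proof.
move=> kj cu Q x y PQ Qx Qy; move: PQ; rewrite -(subnKC kj) => PQ.
have [Q' PQ' [QQ' _]] := cell_ancestor PQ.
exact: (cu Q' x y PQ' (QQ' _ Qx) (QQ' _ Qy)).
Qed.

Lemma cell_constant_block c a k : grid_step k a -> cell_constant k (block P c a k).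
Proof.
move=> step Q x y PQ Qx Qy; rewrite !(block_in _ step PQ)//.
by have [z az] := step _ PQ; rewrite !az !indicE !mem_set.
Qed.

Lemma cell_constant_sum c a n k : (forall k, grid_step k a) -> (n <= k.+1)%N ->
  cell_constant k (fun x => \sum_(0 <= i < n) block P c a i x).
Proof.
move=> step nk Q x y PQ Qx Qy; apply: eq_big_nat => i /andP[_ i_n].
have ik : (i <= k)%N by rewrite -ltnS (leq_trans i_n).
exact: (cell_constant_ge ik (cell_constant_block c (@step i)) PQ Qx Qy).
Qed.

Lemma souza_grid_step s p a k : (forall Q, P k Q -> souza_atom mu s p Q (a Q)) ->
  grid_step k a.
Proof.
move=> sa Q PQ; have [[z az] a0 _] := sa _ PQ; exists z => x.
by rewrite indicE; case: (boolP (x \in Q)) => [/set_mem/az ->|/negP nQ];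
  [rewrite mulr1|rewrite mulr0 a0// => Qx; apply: nQ; rewrite inE].
Qed.

Lemma sum_cells (V : nmodType) (F : set T -> V) k :
  \sum_(Q \in P k) F Q = \sum_(Q <- cells P k) F Q.
Proof. by rewrite fsbig_finite//; exact: finite_cells. Qed.

Lemma block_bounded c a k (M : set T -> R) :
  (forall Q x, P k Q -> cabs (a Q x) <= M Q) ->
  exists2 N : R, 0 <= N & forall x, cabs (block P c a k x) <= N.
Proof.
move=> aM; exists (\sum_(Q <- cells P k) `|cabs (c Q) * M Q|).
  by apply: sumr_ge0 => Q _; exact: normr_ge0.
move=> x; rewrite /block sum_cells.
apply: le_trans (cabs_sum _ _) _; rewrite big_seq [leRHS]big_seq.
apply: ler_sum => Q /cellsP PQ; rewrite cabsM.
by apply: le_trans (ler_norm _); rewrite ler_wpM2l ?cabs_ge0// aM.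
Qed.

Lemma sum_cells_single (F : set T -> R) k Q : P k Q ->
  (forall W, P k W -> W <> Q -> F W = 0) -> \sum_(W <- cells P k) F W = F Q.
Proof.
move=> PQ F0; rewrite (bigD1_seq Q)/= ?cells_uniq//; last exact/cellsP.
rewrite big1_seq ?addr0// => W /andP[/eqP WQ /cellsP PW]; exact: F0.
Qed.

Lemma sum_cells_measure_le k W : measurable W ->
  \sum_(Q <- cells P k) m (Q `&` W) <= m W.
Proof.
move=> mW; rewrite -lee_fin fineK ?fin_num_measure//.
rewrite -sumEFin (eq_big_seq (fun Q => mu (Q `&` W))); last first.
  move=> Q /cellsP PQ; rewrite fineK ?fin_num_measure//.
  by apply: measurableI => //; exact: measurable_cell PQ.
rewrite -(sum_cells (fun Q => mu (Q `&` W))) -measure_fsbig//; last 3 first.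
- exact: finite_cells.
- by move=> Q PQ; apply: measurableI => //; exact: measurable_cell PQ.
- by move=> Q Q' PQ PQ' [x [[Qx _] [Q'x _]]]; exact: (cell_eq PQ PQ' Qx Q'x).
rewrite (fsbig_setU _ (finite_cells k)).
have mU : measurable (\bigcup_(Q in P k) (Q `&` W)).
  apply: fin_bigcup_measurable; first exact: finite_cells.
  by move=> Q PQ; apply: measurableI => //; exact: measurable_cell PQ.
apply: le_measure; rewrite ?inE//.
by move=> x [Q PQ [_ Wx]].
Qed.

(** The cells cover the space up to a null set, so [phi] lies almost everywhere below the step
    function of heights [b]. The set [W] may cut cells, hence the measures of intersections. *)
Lemma integral_step_le k W (phi : T -> R) (b : set T -> R) : measurable W ->
  measurable_fun setT phi -> (forall x, 0 <= phi x) -> (forall Q, 0 <= b Q) ->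
  (forall Q x, P k Q -> Q x -> phi x <= b Q) ->
  (\int[mu]_(x in W) (phi x)%:E <= (\sum_(Q <- cells P k) b Q * m (Q `&` W))%:E)%E.
Proof.
move=> mW mphi phi0 b0 phib.
pose f Q x : \bar R := if Q \in cells P k then (b Q * \1_Q x)%:E else 0%E.
have f0 Q x : (0 <= f Q x)%E by rewrite /f; case: ifP => // _; rewrite lee_fin mulr_ge0.
have mf Q : measurable_fun W (f Q).
  rewrite /f; case: (boolP (Q \in cells P k)) => [/cellsP PQ|_];
    last exact: measurable_cst.
  apply/measurable_EFinP; apply: measurable_funM => //.
  exact: (measurable_indic (measurable_cell PQ)).
apply: (@le_trans _ _ (\int[mu]_(x in W) (\sum_(Q \in P k) f Q x))%E).
  apply: ae_ge0_le_integral => //.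
  - by move=> x _; rewrite lee_fin.
  - apply: (@measurable_funS _ _ _ _ setT) => //; exact/measurable_EFinP.
  - by move=> x _; apply: fsume_ge0.
  - apply: emeasurable_fsum => //; exact: finite_cells.
  - apply: filterS ae_cell => x /(_ k)[Q PQ Qx] _.
    rewrite (fsbigD1 Q)//=; last exact: finite_cells.
    apply: (@le_trans _ _ (f Q x)); last by rewrite leeDl// fsume_ge0.
    rewrite /f ifT; last exact/cellsP.
    rewrite indicE mem_set// mulr1 lee_fin.
    exact: (phib _ _ PQ Qx).
rewrite ge0_integral_fsum//; last exact: finite_cells.
rewrite sum_cells -sumEFin le_eqVlt; apply/orP; left; apply/eqP.
apply: eq_big_seq => Q cQ; have /cellsP PQ := cQ.
under eq_integral do rewrite /f cQ EFinM.
have mQ := measurable_cell PQ.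
rewrite ge0_integralZl//; last 2 first.
- by apply/measurable_EFinP; exact: measurable_indic.
- by rewrite lee_fin.
rewrite integral_indic// EFinM fineK// fin_num_measure//.
exact: measurableI.
Qed.

End grid.

(** * Averages over cells *)

Section cell_averages.
Context (R : realType) (d : measure_display) (T : measurableType d).
Context (mu : {finite_measure set T -> \bar R}) (l1 l2 : R) (P : nat -> set (set T)).
Context (p : R).
Hypothesis gg : good_grid mu l1 l2 P.
Hypothesis p1 : 1 <= p.
Implicit Types (Q W J : set T) (u v : T -> R[i]).

Local Notation m Q := (fine (mu Q)).

Let p0 : 0 < p. Proof. by rewrite (lt_le_trans _ p1). Qed.
Let m_ge0 Q : 0 <= m Q. Proof. by rewrite fine_ge0. Qed.

(** The average over [W] of the step function with value [b J] on each cell [J] of level [k]. *)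
Definition step_avg k (b : set T -> R) W := \sum_(J <- cells P k) m (J `&` W) / m W * b J.

Lemma step_avg_ge0 k b W : (forall J, 0 <= b J) -> 0 <= step_avg k b W.
Proof. by move=> b0; apply: sumr_ge0 => J _; rewrite mulr_ge0// divr_ge0. Qed.

(** Jensen on each [W], whose weights add up to at most 1. After the exchange of sums, each fine
    cell [J] meets only its own ancestor, of which it fills at most the fraction [l2 ^+ (i - k)]. *)
Lemma lpsum_step_avg k i (b : set T -> R) : (k <= i)%N -> (forall J, 0 <= b J) ->
  lpsum (cells P k) p (step_avg i b) <=
  (l2 ^+ (i - k)) `^ p^-1 * lpsum (cells P i) p b.
Proof.
move=> ki b0; have l20 := ltW (l2_gt0 gg).
rewrite le_lpsumP//; last by rewrite mulr_ge0 ?powR_ge0 ?lpsum_ge0.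
rewrite powRM ?powR_ge0 ?lpsum_ge0// lpsum_powR// -powRrM mulVf ?lt0r_neq0//.
rewrite powRr1 ?exprn_ge0//.
apply: (@le_trans _ _ (\sum_(W <- cells P k) \sum_(J <- cells P i)
    m (J `&` W) / m W * b J `^ p)).
  rewrite big_seq [leRHS]big_seq; apply: ler_sum => W /(cellsP gg) PW.
  have mW := cell_gt0 gg PW.
  have := @jensen_powR R _ (cells P i) (fun J => m (J `&` W) / m W) b p 1 p1.
  rewrite powR1 mul1r; apply => //; first by move=> J; rewrite divr_ge0.
  rewrite -mulr_suml ler_pdivrMr// mul1r.
  exact: (sum_cells_measure_le gg _ (measurable_cell gg PW)).
rewrite exchange_big/= mulr_sumr big_seq [leRHS]big_seq.
apply: ler_sum => J /(cellsP gg) PJ; rewrite -mulr_suml ler_wpM2r ?powR_ge0//.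
have /(cell_ancestor gg)[Q PQ [JQ mJ]] : P (k + (i - k))%N J by rewrite subnKC.
have mQ := cell_gt0 gg PQ.
rewrite (sum_cells_single gg PQ) => [|W PW WQ].
  by rewrite (setIidl JQ) ler_pdivrMr.
rewrite (_ : J `&` W = set0) ?measure0 ?mul0r// -subset0 => x [Jx Wx].
by apply: WQ; exact: (cell_eq gg PW PQ Wx (JQ _ Jx)).
Qed.

Definition parent k W : set T := xget set0 [set Q | P k Q /\ W `<=` Q].

Lemma parentP k W : P k.+1 W -> P k (parent k W) /\ W `<=` parent k W.
Proof.
move=> PW; rewrite /parent.
have [Q PQ WQ] : exists2 Q, P k Q & W `<=` Q.
  by case: gg => _ [_ [_ _ par _ _]]; exact: par.
exact: (@xgetPex _ set0 [set Q | P k Q /\ W `<=` Q] (ex_intro _ Q (conj PQ WQ))).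
Qed.

(** Each [b Q] is repeated once per child of [Q]. The children are counted by measure: each fills at
    least the fraction [l1] of [Q], so [1 <= l1^-1 * (m W / m Q)], and these fractions add up to at
    most 1. *)
Lemma lpsum_parent k (b : set T -> R) : (forall J, 0 <= b J) ->
  lpsum (cells P k.+1) p (fun W => b (parent k W)) <=
  l1^-1 `^ p^-1 * lpsum (cells P k) p b.
Proof.
move=> b0; have l10 := l1_gt0 gg; have l1i0 : 0 <= l1^-1 by rewrite invr_ge0 ltW.
rewrite le_lpsumP//; last by rewrite mulr_ge0 ?powR_ge0 ?lpsum_ge0.
rewrite powRM ?powR_ge0 ?lpsum_ge0// lpsum_powR// -powRrM mulVf ?lt0r_neq0//.
rewrite powRr1//.
apply: (@le_trans _ _ (\sum_(W <- cells P k.+1) \sum_(Q <- cells P k)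
    l1^-1 * (m (W `&` Q) / m Q) * b Q `^ p)).
  rewrite big_seq [leRHS]big_seq; apply: ler_sum => W /(cellsP gg) PW.
  have [PQ WQ] := parentP PW; have mQ := cell_gt0 gg PQ.
  rewrite (sum_cells_single gg PQ) => [|Q PQ' QW]; last first.
    rewrite (_ : W `&` Q = set0) ?measure0 ?mul0r ?mulr0 ?mul0r// -subset0 => x [Wx Qx].
    by apply: QW; exact: (cell_eq gg PQ' PQ Qx (WQ _ Wx)).
  rewrite -[leLHS]mul1r ler_wpM2r ?powR_ge0// (setIidl WQ) mulrC ler_pdivlMr//.
  by have /andP[] := cell_ratio gg PW PQ WQ; rewrite ler_pdivlMr// mul1r mulrC.
rewrite exchange_big/= mulr_sumr big_seq [leRHS]big_seq.
apply: ler_sum => Q /(cellsP gg) PQ; have mQ := cell_gt0 gg PQ.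
rewrite -mulr_suml ler_wpM2r ?powR_ge0// -mulr_sumr -[leRHS]mulr1 ler_wpM2l//.
rewrite -mulr_suml ler_pdivrMr// mul1r.
exact: (sum_cells_measure_le gg _ (measurable_cell gg PQ)).
Qed.

Definition cavg u W : R[i] := cint mu W u * (((m W)^-1)%:C)%C.

Lemma cL1_block c a k (M : set T -> R) : grid_step P k a ->
  (forall Q x, P k Q -> cabs (a Q x) <= M Q) -> cL1 mu (block P c a k).
Proof.
move=> step aM; have [N _ bN] := @block_bounded _ _ _ _ _ _ _ gg c a k M aM.
exact: (cL1_bounded _ (cmeasurable_block gg c step) bN).
Qed.

(** The bound 1 on the atoms is the one of smoothness [1 / p], for which the exponent of the measure
    of the cell vanishes. *)
Lemma absint_block c a k W : grid_step P k a ->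
  (forall Q x, P k Q -> cabs (a Q x) <= 1) -> measurable W -> 0 < m W ->
  absint mu W (block P c a k) <= step_avg k (fun J => cabs (c J)) W * m W.
Proof.
move=> step a1 mW mW0; rewrite -lee_fin absintE//; last first.
  exact: (@cL1_block _ _ _ (fun=> 1)).
apply: le_trans (@integral_step_le _ _ _ _ _ _ _ gg k W
  (fun x => cabs (block P c a k x)) (fun J => cabs (c J)) mW _ _ _ _) _.
- by apply: measurable_cabs; exact: (cmeasurable_block gg).
- by move=> x; exact: cabs_ge0.
- by move=> x; exact: cabs_ge0.
- move=> Q x PQ Qx; rewrite (block_in gg _ step PQ Qx) cabsM /=.
  by rewrite -[leRHS]mulr1 ler_wpM2l ?cabs_ge0// (a1 _ _ PQ).
- rewrite lee_fin /step_avg mulr_suml; apply: ler_sum => J _.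
  by rewrite mulrAC divfK ?lt0r_neq0// mulrC.
Qed.

(** On [V] the function [S] equals its own average, so the left side is the modulus of the average
    of [g - S]. *)
Lemma cavg_sub_le g (S : T -> R[i]) k V x : P k V -> V x -> cL1 mu g -> cL1 mu S ->
  cell_constant P k S ->
  cabs (cavg g V - S x) <= absint mu V (fun x => g x - S x) / m V.
Proof.
move=> PV Vx Lg LS cS; have mV := measurable_cell gg PV.
have mV0 := cell_gt0 gg PV.
have -> : cavg g V - S x = cint mu V (fun x => g x - S x) * (((m V)^-1)%:C)%C.
  rewrite cintB// mulrBl (@cint_cst _ _ _ _ V S (S x))//; last first.
    by move=> y Vy; exact: (cS V).
  rewrite -mulrA -rmorphM/= divff ?lt0r_neq0// mulr1//.
rewrite cabsM cabs_real ger0_norm ?invr_ge0// ler_wpM2r ?invr_ge0//.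
by apply: cabs_cint => //; exact: cL1B.
Qed.

Section representation.
Context (g : T -> R[i]) (c : set T -> R[i]) (a : set T -> T -> R[i]) (A : R).
Hypothesis Lg : cL1 mu g.
Hypothesis step : forall k, grid_step P k a.
Hypothesis a1 : forall k Q x, P k Q -> cabs (a Q x) <= 1.
Hypothesis cA : forall k, lpsum (cells P k) p (fun J => cabs (c J)) <= A.
Let S n x := \sum_(0 <= k < n) block P c a k x.
Hypothesis cvS : (fun n => absint mu setT (fun x => g x - S n x)) n @[n --> \oo] --> 0.

Let Lblock k : cL1 mu (block P c a k).
Proof. by apply: (@cL1_block _ _ _ (fun=> 1)) => // Q x; exact: a1. Qed.

Let LS n : cL1 mu (S n). Proof. exact: cL1_sum. Qed.

(** The partial sum [S j] is constant on [V] as long as [j <= k.+1]. The difference [g - S j] is cut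
    at [n] into finitely many blocks and a tail. The tail may be integrated over the whole space,
    since [n] tends to infinity with [V] fixed. *)
Lemma cavg_sub_partial_le k n V x : P k V -> V x -> (k < n)%N ->
  forall j, (j <= k.+1)%N -> (j <= n)%N ->
  cabs (cavg g V - S j x) <=
  \sum_(j <= i < n) step_avg i (fun J => cabs (c J)) V +
  absint mu setT (fun x => g x - S n x) / m V.
Proof.
move=> PV Vx kn j jk jn; have mV := measurable_cell gg PV.
have mV0 := cell_gt0 gg PV.
have cS : cell_constant P k (S j) by exact: (cell_constant_sum gg).
apply: le_trans (cavg_sub_le PV Vx Lg (LS j) cS) _.
rewrite ler_pdivrMr// mulrDl divfK ?lt0r_neq0// addrC.
apply: (@le_trans _ _ (absint mu V (fun x => g x - S n x) +
    absint mu V (fun x => \sum_(j <= i < n) block P c a i x))).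
  apply: absint_le3 => //; [exact: cL1B|exact: cL1B|exact: cL1_sum|].
  move=> y Vy; apply: le_trans (cabsD _ _).
  by rewrite /S (@big_cat_nat _ _ _ j 0 n)//= opprD addrA subrK.
apply: lerD.
  by apply: absint_subset => //; exact: cL1B.
apply: le_trans (absint_sum _ mV Lblock) _.
rewrite mulr_suml; apply: ler_sum => i _; apply: absint_block => // Q y; exact: a1.
Qed.

(** Both averages are compared with the same number, the value of [S k.+1] at a point of [W]; this
    is how the coarse blocks cancel. In the numerator, [1] comes from [W] and the power of [l1^-1]
    from the repetition of the parents. *)
Lemma lpsum_cavg_diff k :
  lpsum (cells P k.+1) p (fun W => cabs (cavg g W - cavg g (parent k W))) <=
  (1 + l1^-1 `^ p^-1) / (1 - l2 `^ p^-1) * A.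
Proof.
have l20 := l2_gt0 gg.
pose t := l2 `^ p^-1.
have t0 : 0 < t by exact: powR_gt0.
have t1 : t < 1 by rewrite (l2_powR_lt1 gg)// invr_gt0.
have A0 : 0 <= A by exact: le_trans (lpsum_ge0 _ _ _) (cA 0%N).
have tpow i : (l2 ^+ i) `^ p^-1 = t ^+ i by exact: powR_exprn (ltW l20).
pose eta n := absint mu setT (fun x => g x - S n x).
have eta0 n : 0 <= eta n by exact: absint_ge0.
(* [L] depends on [k] but not on [n], so the tail contribution [eta n * L] vanishes in the limit. *)
pose L := lpsum (cells P k.+1) p (fun W => (m W)^-1 + (m (parent k W))^-1).
have L0 : 0 <= L by exact: lpsum_ge0.
pose B := (1 + l1^-1 `^ p^-1) / (1 - t) * A.
pose y i W := step_avg i (fun J => cabs (c J)) W +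
  step_avg i (fun J => cabs (c J)) (parent k W).
have sa0 i W : 0 <= step_avg i (fun J => cabs (c J)) W.
  by apply: step_avg_ge0 => J; exact: cabs_ge0.
have y0 i W : 0 <= y i W by rewrite addr_ge0.
have key n : (k.+1 < n)%N ->
    lpsum (cells P k.+1) p (fun W => cabs (cavg g W - cavg g (parent k W))) <=
    B + eta n * L.
  move=> kn.
  apply: (@le_trans _ _ (lpsum (cells P k.+1) p (fun W =>
    \sum_(k.+1 <= i < n) y i W + eta n * ((m W)^-1 + (m (parent k W))^-1)))).
    apply: le_lpsum => // W /(cellsP gg) PW; rewrite cabs_ge0 andTb.
    have [PQ WQ] := parentP PW; have [x Wx] := cell_nonempty gg PW.
    have h1 := @cavg_sub_partial_le k.+1 n W x PW Wx kn k.+1 (leqnSn _) (ltnW kn).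
    have h2 := @cavg_sub_partial_le k n _ x PQ (WQ _ Wx) (ltnW kn) k.+1
      (leqnn _) (ltnW kn).
    rewrite /y big_split mulrDr addrACA.
    apply: le_trans (lerD h1 h2); apply: le_trans (cabsB _ _).
    by rewrite opprB addrA subrK.
  apply: le_trans (lpsumD _ _ _ _) _ => //.
  - by move=> W; apply: sumr_ge0.
  - by move=> W; rewrite mulr_ge0 ?addr_ge0 ?invr_ge0.
  apply: lerD; last first.
    by rewrite lpsumZ// => W; rewrite addr_ge0 ?invr_ge0.
  apply: le_trans (lpsum_sum _ p1 _ y0) _.
  apply: (@le_trans _ _ (\sum_(k.+1 <= i < n)
      t ^+ (i - k.+1) * ((1 + l1^-1 `^ p^-1) * A))).
    rewrite big_nat [leRHS]big_nat; apply: ler_sum => i /andP[ki _].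
    apply: le_trans (lpsumD _ p1 (sa0 i) (fun W => sa0 i (parent k W))) _.
    rewrite mulrDl mul1r mulrDr; apply: lerD.
      apply: le_trans (lpsum_step_avg ki (fun J => cabs_ge0 (c J))) _.
      by rewrite tpow ler_wpM2l ?exprn_ge0// ltW.
    apply: le_trans (lpsum_parent _ (sa0 i)) _.
    rewrite mulrCA ler_wpM2l ?powR_ge0//.
    apply: le_trans (lpsum_step_avg (ltnW ki) (fun J => cabs_ge0 (c J))) _.
    (* The parent is one level higher and gives [t ^+ (i - k)]; one factor [t] is given up so that
       both parts share a geometric series. *)
    rewrite tpow ler_pM ?exprn_ge0 ?lpsum_ge0 ?(ltW t0)//.
    by rewrite ler_wiXn2l ?(ltW t0) ?(ltW t1)// leq_sub2l.
  rewrite -mulr_suml /B [leRHS]mulrC [leRHS]mulrA [leRHS]mulrC [A * _]mulrC.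
  rewrite ler_wpM2r ?mulr_ge0 ?addr_ge0 ?powR_ge0//.
  rewrite -[k.+1 in leLHS]add0n big_addn big_mkord.
  under eq_bigr do rewrite addnK.
  exact: sum_exprn_le.
have cvB : (fun n => B + eta n * L) n @[n --> \oo] --> B.
  rewrite -[X in _ --> X]addr0 -(mul0r L).
  by apply: cvgD; [exact: cvg_cst|apply: cvgMl; exact: cvS].
rewrite -/t -/B; apply: (@ler_cvg_to _ _ _ _ (fun=> _) (fun n => B + eta n * L)) cvB _.
- exact: cvg_cst.
- by exists k.+2 => // n /= kn; exact: key.
Qed.

End representation.

End cell_averages.

(** * Size and summability of blocks *)

Section blocks.
Context (R : realType) (d : measure_display) (T : measurableType d).
Context (mu : {finite_measure set T -> \bar R}) (l1 l2 : R) (P : nat -> set (set T)).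
Context (p : R).
Hypothesis gg : good_grid mu l1 l2 P.
Hypothesis p1 : 1 <= p.
Implicit Types (Q W J : set T) (u v : T -> R[i]) (c : set T -> R[i]).

Local Notation m Q := (fine (mu Q)).

Let p0 : 0 < p. Proof. by rewrite (lt_le_trans _ p1). Qed.
Let m_ge0 Q : 0 <= m Q. Proof. by rewrite fine_ge0. Qed.

Definition level_norm c k : R := lpsum (cells P k) p (fun Q => cabs (c Q)).

Lemma level_norm_ge0 c k : 0 <= level_norm c k.
Proof. exact: lpsum_ge0. Qed.

Lemma costE (q : \bar R) c : cost P p q c = seq_norm q (level_norm c).
Proof.
have E k : \sum_(Q \in P k) cabs (c Q) `^ p = \sum_(Q <- cells P k) cabs (c Q) `^ p.
  by rewrite (sum_cells gg).
have E2 : (fun k => ((\sum_(Q \in P k) cabs (c Q) `^ p) `^ p^-1)%:E) =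
    (fun k => (level_norm c k)%:E).
  by apply/funext => k; rewrite E.
case: q => [r||]; rewrite /cost /seq_norm.
- congr (_ `^ _)%E; apply: eq_eseriesr => k _.
  by rewrite E /level_norm /lpsum -powRrM (mulrC p^-1).
- by rewrite E2.
- by rewrite E2.
Qed.

(** On a cell the p-th power integrates to at most [|c Q|^p |Q|^(s p - 1) |Q| = |c Q|^p |Q|^(s p)],
    and [|Q|] is at most [l2 ^+ k] times the total measure. *)
Lemma cLnorm_block_le (s : R) c a k : 0 < s ->
  (forall Q, P k Q -> souza_atom mu s p Q (a Q)) ->
  (cLnorm mu p%:E (block P c a k) <=
   ((l2 ^+ k * m setT) `^ s * level_norm c k)%:E)%E.
Proof.
move=> s0 sa; have step := souza_grid_step sa.
pose b Q := (cabs (c Q) * m Q `^ (s - p^-1)) `^ p.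
have b0 Q : 0 <= b Q by exact: powR_ge0.
have le : (\int[mu]_x (cabs (block P c a k x) `^ p)%:E <=
    (((l2 ^+ k * m setT) `^ s * level_norm c k) `^ p)%:E)%E.
  apply: le_trans (@integral_step_le _ _ _ _ _ _ _ gg k setT
    (fun x => cabs (block P c a k x) `^ p) b measurableT _ _ b0 _) _.
  - by apply/measurable_EFinP/measurable_cabs_powR; exact: (cmeasurable_block gg).
  - by move=> x; exact: powR_ge0.
  - move=> Q x PQ Qx; rewrite (block_in gg _ step PQ Qx) cabsM.
    have [_ _ aQ] := sa _ PQ.
    rewrite ge0_ler_powR ?nnegrE ?(ltW p0)// ?mulr_ge0 ?cabs_ge0 ?powR_ge0//.
    by rewrite ler_wpM2l ?cabs_ge0.
  - rewrite lee_fin powRM ?powR_ge0 ?level_norm_ge0// /level_norm lpsum_powR//.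
    rewrite mulr_sumr big_seq [leRHS]big_seq; apply: ler_sum => Q /(cellsP gg) PQ.
    have mQ := cell_gt0 gg PQ.
    have -> : b Q = cabs (c Q) `^ p * (m Q `^ (s - p^-1)) `^ p.
      by rewrite /b powRM ?powR_ge0 ?cabs_ge0.
    rewrite setIT -mulrA [leRHS]mulrC ler_wpM2l ?powR_ge0//.
    have -> : m Q `^ (s - p^-1) `^ p * m Q = (m Q `^ s) `^ p.
      rewrite -!powRrM mulrBl mulVf ?lt0r_neq0// -{2}[m Q]powRr1 ?(ltW mQ)//.
      by rewrite -powRD ?subrK// lt0r_neq0// implybT.
    rewrite ge0_ler_powR ?nnegrE ?powR_ge0 ?(ltW p0)//.
    rewrite ge0_ler_powR ?nnegrE ?(ltW s0) ?(ltW mQ)//.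
      by rewrite mulr_ge0 ?exprn_ge0 ?(ltW (l2_gt0 gg)).
    exact: (cell_measure_le gg).
rewrite cLnormE.
have -> : ((l2 ^+ k * m setT) `^ s * level_norm c k)%:E =
    (((((l2 ^+ k * m setT) `^ s * level_norm c k) `^ p)%:E) `^ p^-1)%E.
  rewrite poweR_EFin -powRrM divff ?lt0r_neq0// powRr1//.
  by rewrite mulr_ge0 ?powR_ge0 ?level_norm_ge0.
rewrite gt0_ler_poweR ?invr_ge0 ?(ltW p0)// in_itv/= leey andbT.
  by apply: integral_ge0 => x _; rewrite lee_fin powR_ge0.
by rewrite lee_fin powR_ge0.
Qed.

(** The level norms are bounded by the cost and the block sizes decay like [l2^(s k)]. For the
    product, this supplies the absolute convergence demanded of a representation. *)
Lemma cLnorm_blocks_summable (s : R) (q : \bar R) c a : 0 < s -> (1 <= q)%E ->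
  (forall k Q, P k Q -> souza_atom mu s p Q (a Q)) ->
  (cost P p q c < +oo)%E ->
  (\sum_(0 <= k <oo) cLnorm mu p%:E (block P c a k) < +oo)%E.
Proof.
move=> s0 q1 sa; rewrite costE => cfin.
have l20 := l2_gt0 gg.
set E := seq_norm q _ in cfin.
have E0 : (0 <= E)%E by apply: seq_norm_ge0 => // k; exact: level_norm_ge0.
have Enum : E \is a fin_num by rewrite ge0_fin_numE.
pose t := l2 `^ s.
have t0 : 0 < t by exact: powR_gt0.
have t1 : t < 1 by exact: (l2_powR_lt1 gg).
pose K := m setT `^ s * fine E.
have K0 : 0 <= K by rewrite mulr_ge0 ?powR_ge0 ?fine_ge0.
apply: (@le_lt_trans _ _ (K / (1 - t))%:E); last exact: ltry.
apply: nneseries_le => [k|n]; first exact: cLnorm_ge0.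
apply: (@le_trans _ _ (\sum_(0 <= k < n) (K * t ^+ k)%:E)%E).
  apply: lee_sum => k _; apply: le_trans (cLnorm_block_le c s0 (sa k)) _.
  rewrite lee_fin /K powRM ?exprn_ge0 ?(ltW l20)//.
  rewrite powR_exprn ?(ltW l20)// -/t.
  rewrite -mulrA [leRHS]mulrC ler_wpM2l ?exprn_ge0 ?(ltW t0)//.
  rewrite ler_wpM2l ?powR_ge0// -lee_fin fineK//.
  by apply: le_seq_norm => // j; exact: level_norm_ge0.
rewrite sumEFin lee_fin -mulr_sumr ler_wpM2l// big_mkord.
exact: sum_exprn_le.
Qed.

Lemma sum_absint_cells k u : cL1 mu u ->
  \sum_(Q <- cells P k) absint mu Q u <= absint mu setT u.
Proof.
move=> Lu; rewrite -lee_fin absintE// -sumEFin.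
rewrite (eq_big_seq (fun Q => (\int[mu]_(x in Q) (cabs (u x))%:E)%E)); last first.
  by move=> Q /(cellsP gg) PQ; rewrite absintE//; exact: (measurable_cell gg PQ).
have mc : measurable_fun setT (fun x => (cabs (u x))%:E).
  by apply/measurable_EFinP/measurable_cabs; case: Lu.
(* The guard makes [h Q] measurable for every set [Q], cell or not. *)
pose h Q : T -> \bar R := if Q \in cells P k then
  ((fun x => (cabs (u x))%:E) \_ Q) else (fun=> 0%E).
have h0 Q x : (0 <= h Q x)%E.
  rewrite /h; case: ifP => // _; rewrite /patch; case: ifP => // _.
  by rewrite lee_fin cabs_ge0.
have mh Q : measurable_fun setT (h Q).
  rewrite /h; case: (boolP (Q \in cells P k)) => [/(cellsP gg) PQ|_].
    apply/(measurable_restrictT _ (measurable_cell gg PQ)).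
    exact: (measurable_funS _ _ mc).
  exact: measurable_cst.
rewrite (eq_big_seq (fun Q => (\int[mu]_x h Q x)%E)); last first.
  by move=> Q cQ; rewrite integral_mkcond /h cQ.
rewrite -(sum_cells gg) -ge0_integral_fsum//; last exact: (finite_cells gg).
apply: ae_ge0_le_integral => //.
- by move=> x _; apply: fsume_ge0.
- by apply: emeasurable_fsum => //; exact: (finite_cells gg).
- by move=> x _; rewrite lee_fin cabs_ge0.
- apply: filterS (ae_cell gg) => x /(_ k)[Q PQ Qx] _.
  rewrite (fsbigD1 Q)//=; last exact: (finite_cells gg).
  rewrite fsbig1 => [|W [PW WQ]].
    rewrite adde0 /h; case: ifP => _; first by rewrite patchE mem_set.
    by rewrite lee_fin cabs_ge0.
  rewrite /h; case: ifP => // _; rewrite patchE memNset// => Wx; apply: WQ.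
  exact: (cell_eq gg PW PQ Wx Qx).
Qed.

End blocks.

(** * Values, levels and means on cells *)

Section cell_values.
Context (R : realType) (d : measure_display) (T : measurableType d).
Context (mu : {finite_measure set T -> \bar R}) (l1 l2 : R) (P : nat -> set (set T)).
Hypothesis gg : good_grid mu l1 l2 P.
Implicit Types (Q W : set T) (u v : T -> R[i]).

Local Notation m Q := (fine (mu Q)).

Definition cell_indic Q (x : T) : R[i] := ((\1_Q x : R)%:C)%C.

Lemma grid_step_indic k : grid_step P k cell_indic.
Proof. by move=> Q _; exists 1 => x; rewrite mul1r. Qed.

Lemma cell_indicE Q x : Q x -> cell_indic Q x = 1.
Proof. by move=> Qx; rewrite /cell_indic indicE mem_set. Qed.

(* The value on [W] of a function that is constant on [W]. *)
Definition cell_value u W : R[i] := xget 0 [set z | exists2 x, W x & u x = z].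

Lemma cell_valueE k u W x : cell_constant P k u -> P k W -> W x ->
  cell_value u W = u x.
Proof.
move=> cu PW Wx; rewrite /cell_value; case: xgetP => [z _ [y Wy <-]|none].
  exact: (cu W y x).
by exfalso; apply: (none (u x)); exists x.
Qed.

(* The level of a cell; junk on sets that are not cells. *)
Definition cell_index W : nat := xget 0%N [set k | P k W].

Lemma cell_indexE k W : P k W -> cell_index W = k.
Proof.
move=> PW; rewrite /cell_index; case: xgetP => [j _ PjW|none].
  exact: (cell_level gg PjW PW).
by exfalso; exact: (none k).
Qed.

Lemma cell_constantM k u v : cell_constant P k u -> cell_constant P k v ->
  cell_constant P k (fun x => u x * v x).
Proof.
by move=> cu cv Q x y PQ Qx Qy; rewrite (cu Q x y)// (cv Q x y).
Qed.

(* Shifted by one: [cell_mean u k.+1] is the conditional expectation of [u] on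
   the cells of [P k], to be paired with the sum of the blocks of level [< k.+1]. *)
Definition cell_mean u n : T -> R[i] :=
  if n is k.+1 then block P (cavg mu u) cell_indic k else fun=> 0.

Lemma cell_mean_in u k Q x : P k Q -> Q x -> cell_mean u k.+1 x = cavg mu u Q.
Proof.
move=> PQ Qx; rewrite /cell_mean (block_in gg _ (grid_step_indic (k:=k)) PQ Qx).
by rewrite cell_indicE// mulr1.
Qed.

Lemma cmeasurable_cell_mean u n : cmeasurable (cell_mean u n).
Proof.
case: n => [|k]; first exact: cmeasurable_cst.
exact: (cmeasurable_block gg _ (grid_step_indic (k:=k))).
Qed.

Lemma cell_constant_mean u n k : (n <= k.+1)%N -> cell_constant P k (cell_mean u n).
Proof.
case: n => [|n]; first by move=> _ Q x y.
rewrite ltnS => nk; apply: (cell_constant_ge gg nk).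
exact: (cell_constant_block gg _ (grid_step_indic (k:=n))).
Qed.

(** The bound on [u] holds almost everywhere, the one on its mean everywhere: averages ignore null
    sets, and the mean is 0 off the cells. *)
Lemma cell_mean_le u (M : R) n x : cL1 mu u -> 0 <= M ->
  {ae mu, forall x, cabs (u x) <= M} -> cabs (cell_mean u n x) <= M.
Proof.
move=> Lu M0 uM; case: n => [|k]; first by rewrite /cell_mean cabs0.
have [[Q [PQ Qx]]|none] := pselect (exists Q, P k Q /\ Q x); last first.
  rewrite /cell_mean (block_out _ (grid_step_indic (k:=k))) ?cabs0// => Q PQ Qx.
  by apply: none; exists Q.
have mQ := cell_gt0 gg PQ; have mmQ := measurable_cell gg PQ.
rewrite (cell_mean_in _ PQ Qx) /cavg cabsM cabs_real ger0_norm ?invr_ge0 ?(ltW mQ)//.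
rewrite ler_pdivrMr//; apply: le_trans (cabs_cint mmQ Lu) _.
exact: absint_ae_le.
Qed.

Lemma cL1_cell_mean u n : cL1 mu (cell_mean u n).
Proof.
case: n => [|k].
  by apply: (@cL1_bounded _ _ _ _ _ 0) => [|x]; [exact: cmeasurable_cst|rewrite cabs0].
have indic_le1 Q x : P k Q -> cabs (cell_indic Q x) <= 1.
  by rewrite /cell_indic cabs_real ger0_norm// indicE; case: (_ \in _).
have [N _ uN] := @block_bounded _ _ _ _ _ _ _ gg (cavg mu u) cell_indic k
  (fun=> 1) indic_le1.
by apply: (cL1_bounded _ _ uN); exact: (cmeasurable_cell_mean u k.+1).
Qed.

(* The cell mean is an L^1 contraction fixing [v]. *)
Lemma absint_sub_cell_mean_le u v n : cL1 mu u -> cL1 mu v ->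
  cell_constant P n v ->
  absint mu setT (fun x => u x - cell_mean u n.+1 x) <=
  2 * absint mu setT (fun x => u x - v x).
Proof.
move=> Lu Lv cv; have LB := cL1B Lu Lv; have Lm := cL1_cell_mean u n.+1.
rewrite mulrDl mul1r; apply: le_trans (_ : _ <= absint mu setT (fun x => u x - v x) +
    absint mu setT (fun x => v x - cell_mean u n.+1 x)) _.
  apply: absint_le3 => //; [exact: cL1B|exact: cL1B|] => x _.
  by apply: le_trans (cabsD _ _); rewrite addrA subrK.
rewrite lerD2l; apply: le_trans (sum_absint_cells gg n LB).
rewrite -lee_fin absintE//; last exact: cL1B.
apply: le_trans (@integral_step_le _ _ _ _ _ _ _ gg n setT
    (fun x => cabs (v x - cell_mean u n.+1 x))
    (fun Q => absint mu Q (fun x => u x - v x) / m Q) measurableT _ _ _ _) _.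
- by apply: measurable_cabs; apply: cmeasurableB; [case: Lv|exact: cmeasurable_cell_mean].
- by move=> x; exact: cabs_ge0.
- by move=> Q; rewrite divr_ge0 ?absint_ge0 ?fine_ge0.
- move=> Q x PQ Qx; rewrite -cabsN opprB (cell_mean_in _ PQ Qx).
  exact: (cavg_sub_le gg PQ Qx).
- rewrite lee_fin big_seq [leRHS]big_seq; apply: ler_sum => Q /(cellsP gg) PQ.
  by rewrite setIT divfK// lt0r_neq0// (cell_gt0 gg PQ).
Qed.

End cell_values.

(** * The product of two representations *)

Section product.
Context (R : realType) (d : measure_display) (T : measurableType d).
Context (mu : {finite_measure set T -> \bar R}) (l1 l2 : R) (P : nat -> set (set T)).
Context (p s : R) (q : \bar R) (g f : T -> R[i]) (G D : R).
Context (cg cf : set T -> R[i]) (ag af : set T -> T -> R[i]).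
Hypothesis gg : good_grid mu l1 l2 P.
Hypothesis p1 : 1 <= p.
Hypothesis q1 : (1 <= q)%E.
Hypothesis s0 : 0 < s.
Hypothesis sp : s < p^-1.
Hypothesis gm : cmeasurable g.
Hypothesis G0 : 0 <= G.
Hypothesis gG : {ae mu, forall x, cabs (g x) <= G}.
Hypothesis g_step : forall k, grid_step P k ag.
Hypothesis ag1 : forall k Q x, P k Q -> cabs (ag Q x) <= 1.
Hypothesis g_cvg : absint mu setT
  (fun x => g x - \sum_(0 <= k < n) block P cg ag k x) @[n --> \oo] --> 0.
Hypothesis D0 : 0 <= D.
Hypothesis gD : forall k, lpsum (cells P k.+1) p
  (fun W => cabs (cavg mu g W - cavg mu g (parent P k W))) <= D.
Hypothesis fm : cmeasurable f.
Hypothesis f_rep : souza_representation mu P s p f cf af.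
Hypothesis f_cost : (cost P p q cf < +oo)%E.
Implicit Types (Q W : set T).

Local Notation m Q := (fine (mu Q)).

Let p0 : 0 < p. Proof. by rewrite (lt_le_trans _ p1). Qed.
Let m_ge0 Q : 0 <= m Q. Proof. by rewrite fine_ge0. Qed.

Let f_atom k Q : P k Q -> souza_atom mu s p Q (af Q).
Proof. by case: f_rep => h _ _; exact: h. Qed.

Let f_step k : grid_step P k af.
Proof. exact: souza_grid_step (@f_atom k). Qed.

Let Lg : cL1 mu g.
Proof.
split => //; apply: (@le_lt_trans _ _ (\int[mu]_x (cst G%:E x))%E).
  apply: ae_ge0_le_integral => //.
  - by move=> x _; rewrite lee_fin cabs_ge0.
  - exact/measurable_EFinP/measurable_cabs.
  - by apply: filterS gG => x gx _; rewrite lee_fin.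
by rewrite integral_cst// ltey_eq fin_numM// fin_num_measure.
Qed.

Let F n x := \sum_(0 <= k < n) block P cf af k x.
Let Gn n := cell_mean mu P g n.
Let H n x := Gn n x * F n x.

Let cF n : cmeasurable (F n).
Proof. by apply: cmeasurable_sum => k; exact: (cmeasurable_block gg _ (@f_step k)). Qed.

Let cGn n : cmeasurable (Gn n).
Proof. exact: (cmeasurable_cell_mean gg). Qed.

Let GnG n x : cabs (Gn n x) <= G.
Proof. exact: (cell_mean_le gg). Qed.

Let H_const n k : (n <= k.+1)%N -> cell_constant P k (H n).
Proof.
move=> nk; apply: cell_constantM; first exact: (cell_constant_mean gg).
exact: (cell_constant_sum gg).
Qed.

(** Chosen so that the block of level [k] is the increment [H k.+1 - H k], constant on the cells of
    that level. The atom has the largest size allowed, and the coefficient undoes this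
    normalisation. *)
Definition product_coef W : R[i] :=
  ((m W `^ (p^-1 - s))%:C)%C *
  (cell_value (H (cell_index P W).+1) W - cell_value (H (cell_index P W)) W).

Definition product_atom Q x : R[i] := ((m Q `^ (s - p^-1))%:C)%C * cell_indic R Q x.

Let product_coefE k W x : P k W -> W x ->
  product_coef W = ((m W `^ (p^-1 - s))%:C)%C * (H k.+1 x - H k x).
Proof.
move=> PW Wx; rewrite /product_coef (cell_indexE gg PW).
rewrite (cell_valueE (H_const (leqnn k.+1)) PW Wx).
by rewrite (cell_valueE (H_const (leqnSn k)) PW Wx).
Qed.

Lemma product_atomP k Q : P k Q -> souza_atom mu s p Q (product_atom Q).
Proof.
move=> PQ; rewrite /product_atom; split.
- by exists ((m Q `^ (s - p^-1))%:C)%C => x Qx; rewrite cell_indicE// mulr1.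
- by move=> x nQx; rewrite /cell_indic indicE memNset// mulr0.
- move=> x; rewrite cabsM /cell_indic !cabs_real !ger0_norm ?powR_ge0//.
  by rewrite -[leRHS]mulr1 ler_wpM2l ?powR_ge0// indicE; case: (_ \in _).
Qed.

Let product_step k : grid_step P k product_atom.
Proof. exact: souza_grid_step (@product_atomP k). Qed.

Let product_block k W x : P k W -> W x ->
  block P product_coef product_atom k x = H k.+1 x - H k x.
Proof.
move=> PW Wx; rewrite (block_in gg _ (@product_step k) PW Wx) (product_coefE PW Wx).
rewrite /product_atom cell_indicE// mulr1 mulrAC -rmorphM/=.
by rewrite -powRD ?subrKA ?subrr ?powRr0 ?mul1r// lt0r_neq0 ?implybT// (cell_gt0 gg PW).
Qed.

Let product_partial : {ae mu, forall x, forall n,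
  \sum_(0 <= k < n) block P product_coef product_atom k x = H n x}.
Proof.
apply: filterS (ae_cell gg) => x cx n.
rewrite (eq_bigr (fun k => H k.+1 x - H k x)); last first.
  by move=> k _; have [W PW Wx] := cx k; exact: (product_block PW Wx).
by rewrite telescope_sumr// {2}/H /Gn /cell_mean mul0r subr0.
Qed.

Let r := l2 `^ (p^-1 - s).

Let r0 : 0 < r. Proof. by rewrite powR_gt0// (l2_gt0 gg). Qed.

Let r1 : r < 1.
Proof. by rewrite /r (l2_powR_lt1 gg)// subr_gt0. Qed.

Let E := level_norm P p cf.

Let E0 k : 0 <= E k. Proof. exact: level_norm_ge0. Qed.

(** Only the ancestor [Q] of [W] at level [j] contributes, with a single coefficient, bounded by the
    norm of its level. The powers of measures combine into [(m W / m Q)^(1/p - s)], whose exponent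
    is positive. *)
Let fblock_le j k W x : P (j + k)%N W -> W x ->
  m W `^ (p^-1 - s) * cabs (block P cf af j x) <= r ^+ k * E j.
Proof.
move=> PW Wx; have [Q PQ [WQ mWQ]] := cell_ancestor gg PW.
have mW := cell_gt0 gg PW; have mQ := cell_gt0 gg PQ.
rewrite (block_in gg _ (@f_step j) PQ (WQ _ Wx)) cabsM.
have [_ _ /(_ x) aQ] := f_atom PQ.
apply: (@le_trans _ _ (m W `^ (p^-1 - s) * (E j * m Q `^ (s - p^-1)))).
  rewrite ler_wpM2l ?powR_ge0// ler_pM ?cabs_ge0//.
  apply: (@ler_lpsum _ _ _ _ p1 (fun Q => cabs (cf Q))); last exact/(cellsP gg).
  by move=> J; exact: cabs_ge0.
rewrite mulrCA [leRHS]mulrC ler_wpM2l//.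
rewrite /r -powR_exprn ?(ltW (l2_gt0 gg))//.
have -> : m Q `^ (s - p^-1) = (m Q `^ (p^-1 - s))^-1 by rewrite -powRN opprB.
rewrite ler_pdivrMr ?powR_gt0// -powRM ?exprn_ge0 ?(ltW (l2_gt0 gg))//.
rewrite ge0_ler_powR ?nnegrE ?subr_ge0 ?(ltW sp)//.
by rewrite mulr_ge0 ?exprn_ge0 ?(ltW (l2_gt0 gg)).
Qed.

(* [G] weighs the block of [f] of the same level and [D * r ^+ i] the block
   [i] levels above. *)
Let w i := if i is 0%N then G else D * r ^+ i.

Let product_level_le k : level_norm P p product_coef k <=
  \sum_(j < k.+1) w (k - j)%N * E j.
Proof.
pose Y := \sum_(j < k) r ^+ (k - j) * E j.
have Y0 : 0 <= Y by apply: sumr_ge0 => j _; rewrite mulr_ge0 ?exprn_ge0 ?(ltW r0).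
(* Level 0 has no parent; the value 0 is correct there because [F 0] is the empty sum. *)
pose e W := if k is k'.+1 then cabs (cavg mu g W - cavg mu g (parent P k' W)) else 0.
have e0 W : 0 <= e W by rewrite /e; case: (k) => // j; exact: cabs_ge0.
have eD : lpsum (cells P k) p e <= D.
  rewrite /e; case: (k) => [|j]; last exact: gD.
  have pn0 : p != 0 := lt0r_neq0 p0.
  have pin0 : p^-1 != 0 by rewrite invr_neq0.
  by rewrite /lpsum big1 => [|W _]; rewrite powR0.
rewrite big_ord_recr/= subnn /=.
have -> : \sum_(i < k) w (k - i)%N * E i = D * Y.
  rewrite mulr_sumr; apply: eq_bigr => i _; rewrite mulrA; congr (_ * _).
  by rewrite /w; case: (k - i)%N (subn_gt0 i k) => [|//]; rewrite ltn_ord.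
(* The pairing is sup against l^p: [Y] bounds the rescaled [F k] uniformly over the cells, so only
   the oscillation [e] of [g] is summed over them. *)
apply: (@le_trans _ _ (lpsum (cells P k) p (fun W => Y * e W + G * cabs (cf W)))).
  apply: le_lpsum => // W /(cellsP gg) PW; rewrite cabs_ge0 andTb.
  have [x Wx] := cell_nonempty gg PW.
  have mW0 : 0 <= m W `^ (p^-1 - s) by exact: powR_ge0.
  rewrite (product_coefE PW Wx) cabsM cabs_real (ger0_norm mW0).
  have -> : H k.+1 x - H k x =
      (Gn k.+1 x - Gn k x) * F k x + Gn k.+1 x * block P cf af k x.
    rewrite /H {1}/F big_nat_recr//= -/(F k x).
    by rewrite mulrDr mulrBl addrAC.
  apply: le_trans (ler_wpM2l mW0 (cabsD _ _)) _.
  rewrite mulrDr !cabsM; apply: lerD; last first.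
    rewrite mulrCA ler_pM ?cabs_ge0 ?mulr_ge0 ?cabs_ge0//.
    rewrite (block_in gg _ (@f_step k) PW Wx) cabsM.
    have [_ _ /(_ x) aW] := f_atom PW.
    apply: (@le_trans _ _ (m W `^ (p^-1 - s) * (cabs (cf W) * m W `^ (s - p^-1)))).
      by rewrite ler_wpM2l// ler_wpM2l// cabs_ge0.
    rewrite mulrCA -powRD ?subrKA ?subrr ?powRr0 ?mulr1//.
    by rewrite lt0r_neq0 ?implybT// (cell_gt0 gg PW).
  have GF : cabs (Gn k.+1 x - Gn k x) * cabs (F k x) <= e W * cabs (F k x).
    rewrite /e; move: PW; case: (k) => [|j] PW.
      by rewrite /F big_nil cabs0 !mulr0.
    have [PQ WQ] := parentP gg PW.
    by rewrite /Gn (cell_mean_in gg _ PW Wx) (cell_mean_in gg _ PQ (WQ _ Wx)).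
  apply: le_trans (ler_wpM2l mW0 GF) _; rewrite mulrCA mulrC ler_wpM2r//.
  apply: (@le_trans _ _ (m W `^ (p^-1 - s) * \sum_(j < k) cabs (block P cf af j x))).
    by rewrite ler_wpM2l// /F big_mkord cabs_sum.
  rewrite mulr_sumr; apply: ler_sum => j _; apply: (fblock_le _ Wx).
  by rewrite subnKC// ltnW.
apply: le_trans (lpsumD _ p1 _ _) _.
- by move=> W; rewrite mulr_ge0.
- by move=> W; rewrite mulr_ge0 ?cabs_ge0.
rewrite !lpsumZ//; last by move=> W; exact: cabs_ge0.
by rewrite lerD// mulrC ler_wpM2r.
Qed.

Lemma product_cost : (cost P p q product_coef <= (G + D / (1 - r))%:E * cost P p q cf)%E.
Proof.
rewrite !(costE _ gg); apply: (@seq_norm_conv _ _ q1 _ _ w).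
- by move=> k; exact: level_norm_ge0.
- exact: E0.
- by case=> [|i]; rewrite /w// mulr_ge0// exprn_ge0// ltW.
- case=> [|n].
    by rewrite big_ord0 addr_ge0// divr_ge0// subr_ge0 ltW.
  (* The geometric part of [w] starts at exponent 1; the extra factor [r] is given up. *)
  rewrite big_ord_recl/= lerD2l -mulr_sumr ler_wpM2l//.
  apply: le_trans (sum_exprn_le n r0 r1); apply: ler_sum => i _.
  by rewrite /bump/= add1n ler_wiXn2l ?(ltW r0) ?(ltW r1).
- exact: product_level_le.
- by rewrite -(costE _ gg).
Qed.

Lemma product_cmeasurable : cmeasurable (multiplier g f).
Proof. exact: cmeasurableM. Qed.

Lemma product_cLnorm_le : (cLnorm mu p%:E (multiplier g f) <= G%:E * cLnorm mu p%:E f)%E.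
Proof.
apply: cLnorm_le => //; first exact: product_cmeasurable.
by apply: filterS gG => x gx; rewrite /multiplier cabsM ler_wpM2r ?cabs_ge0.
Qed.

Let F_bounded n : exists2 N : R, 0 <= N & forall x, cabs (F n x) <= N.
Proof.
elim: n => [|n [N N0 FN]]; first by exists 0 => // x; rewrite /F big_nil cabs0.
have [N' N'0 bN] := @block_bounded _ _ _ _ _ _ _ gg cf af n (fun Q => m Q `^ (s - p^-1))
  (fun Q x PQ => let: And3 _ _ h := f_atom PQ in h x).
exists (N + N'); first by rewrite addr_ge0.
move=> x; rewrite /F big_nat_recr//=.
exact: le_trans (cabsD _ _) (lerD (FN x) (bN x)).
Qed.

(** The partial sums of the representation of [g] are constant on cells and tend to [g] in L^1, so
    the means do too by [absint_sub_cell_mean_le]. The uniform bound [G + G] then gives L^p. *)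
Let gGn_cvg : cLnorm mu p%:E (fun x => g x - Gn n x) @[n --> \oo] --> 0%E.
Proof.
apply: (@cLnorm_bounded_cvg0 _ _ _ _ _ p1 _ (G + G)).
- by rewrite addr_ge0.
- by move=> n; exact: cmeasurableB.
- move=> n; apply: filterS gG => x gx; apply: le_trans (cabsB _ _) _.
  by rewrite lerD.
have LGn n : cL1 mu (Gn n) by exact: (cL1_cell_mean gg).
have -> : (fun n => (\int[mu]_x (cabs (g x - Gn n x))%:E)%E) =
    (fun n => (absint mu setT (fun x => g x - Gn n x))%:E).
  by apply/funext => n; rewrite absintE//; exact: cL1B.
apply: cvg_EFin; first exact: nearW.
rewrite -(cvg_shiftS (fun n => absint mu setT (fun x => g x - Gn n x))).
pose eta n := absint mu setT (fun x => g x - \sum_(0 <= k < n) block P cg ag k x).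
apply: (@squeeze_cvgr _ _ _ _ (fun=> 0) (fun n => 2 * eta n.+1)).
- apply: nearW => n; rewrite absint_ge0 andTb /Gn.
  apply: (absint_sub_cell_mean_le gg Lg).
    apply: cL1_sum => k.
    by apply: (@cL1_block _ _ _ _ _ _ _ gg _ _ _ (fun=> 1)) => // Q x; exact: ag1.
  exact: (cell_constant_sum gg).
- exact: cvg_cst.
- rewrite -[X in _ --> X](mulr0 2); apply: cvgMr.
  by rewrite (cvg_shiftS eta).
Qed.

(** Beside [Gn n * (f - F n)] there remains [(g - Gn n) * f], where [f] may be unbounded and [Gn n]
    tends to [g] only in L^p. So [f] is replaced by a partial sum [F M] with [M] fixed, which is
    bounded, and the error [f - F M] is multiplied by the bounded factor [g - Gn n]. *)
Lemma product_cvg : cLnorm mu p%:E (fun x => multiplier g f x -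
  \sum_(0 <= k < n) block P product_coef product_atom k x) @[n --> \oo] --> 0%E.
Proof.
have f_cvg : cLnorm mu p%:E (fun x => f x - F n x) @[n --> \oo] --> 0%E by case: f_rep.
have mB n : cmeasurable (fun x =>
    \sum_(0 <= k < n) block P product_coef product_atom k x).
  by apply: cmeasurable_sum => k; exact: (cmeasurable_block gg).
have -> : (fun n => cLnorm mu p%:E (fun x => multiplier g f x -
    \sum_(0 <= k < n) block P product_coef product_atom k x)) =
  (fun n => cLnorm mu p%:E (fun x => g x * f x - H n x)).
  apply/funext => n; apply: cLnorm_ae_eq => //.
  - by apply: cmeasurableB; first exact: cmeasurableM.
  - by apply: cmeasurableB; exact: cmeasurableM.
  - by apply: filterS product_partial => x /(_ n) ->.
apply/cvge0_nnegP => [n|e e0]; first exact: cLnorm_ge0.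
(* One constant for two factors: [Gn n] is bounded by [G] and [g - Gn n] by [G + G]; the [+ 1] makes
   it positive. *)
pose K := G + (G + G) + 1.
have K0 : 0 < K by rewrite ltr_wpDl// !addr_ge0.
have e30 : 0 < e / (3 * K) by rewrite divr_gt0// mulr_gt0.
have fn0 n : (0 <= cLnorm mu p%:E (fun x => f x - F n x)%R)%E by exact: cLnorm_ge0.
have gn0 n : (0 <= cLnorm mu p%:E (fun x => g x - Gn n x)%R)%E by exact: cLnorm_ge0.
have near_f := (cvge0_nnegP fn0).1 f_cvg _ e30.
have [M _ /(_ M (leqnn M)) fM] := near_f.
have [N N0 FN] := F_bounded M.
have e3N : 0 < e / (3 * (N + 1)) by rewrite divr_gt0// mulr_gt0// ltr_wpDl.
have near_g := (cvge0_nnegP gn0).1 gGn_cvg _ e3N.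
near=> n.
have fn : (cLnorm mu p%:E (fun x => f x - F n x)%R <= (e / (3 * K))%:E)%E by near: n.
have gn : (cLnorm mu p%:E (fun x => g x - Gn n x)%R <=
    (e / (3 * (N + 1)))%:E)%E by near: n.
pose u1 x := Gn n x * (f x - F n x).
pose u2 x := (g x - Gn n x) * (f x - F M x).
pose u3 x := (g x - Gn n x) * F M x.
have m1 : cmeasurable u1 by apply: cmeasurableM => //; exact: cmeasurableB.
have m2 : cmeasurable u2 by apply: cmeasurableM => //; exact: cmeasurableB.
have m3 : cmeasurable u3 by apply: cmeasurableM => //; exact: cmeasurableB.
have -> : (fun x => g x * f x - H n x) = (fun x => u1 x + (u2 x + u3 x)).
  by apply/funext => x; rewrite /u1 /u2 /u3 /H; ring.
have b1 : (cLnorm mu p%:E u1 <= (e / 3)%:E)%E.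
  apply: (@le_trans _ _ (K%:E * cLnorm mu p%:E (fun x => f x - F n x)%R)%E).
    apply: cLnorm_le => //; [exact: cmeasurableB|exact: ltW|].
    apply: aeW => x; rewrite /u1 cabsM ler_wpM2r ?cabs_ge0//.
    by apply: le_trans (GnG n x) _; rewrite /K -!addrA lerDl !addr_ge0.
  apply: le_trans (lee_wpmul2l _ fn) _; first by rewrite lee_fin ltW.
  by rewrite -EFinM lee_fin invfM mulrCA (mulrC K) -!mulrA mulVf ?lt0r_neq0// mulr1.
have b2 : (cLnorm mu p%:E u2 <= (e / 3)%:E)%E.
  apply: (@le_trans _ _ (K%:E * cLnorm mu p%:E (fun x => f x - F M x)%R)%E).
    apply: cLnorm_le => //; [exact: cmeasurableB|exact: ltW|].
    apply: filterS gG => x gx; rewrite /u2 cabsM ler_wpM2r ?cabs_ge0//.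
    apply: le_trans (cabsB _ _) _; apply: le_trans (lerD gx (GnG n x)) _.
    by rewrite /K -addrA [leRHS]addrC -addrA lerDl addr_ge0.
  apply: le_trans (lee_wpmul2l _ fM) _; first by rewrite lee_fin ltW.
  by rewrite -EFinM lee_fin invfM mulrCA (mulrC K) -!mulrA mulVf ?lt0r_neq0// mulr1.
have b3 : (cLnorm mu p%:E u3 <= (e / 3)%:E)%E.
  have N10 : 0 < N + 1 by rewrite ltr_wpDl.
  apply: (@le_trans _ _ ((N + 1)%:E * cLnorm mu p%:E (fun x => g x - Gn n x)%R)%E).
    apply: cLnorm_le => //; [exact: cmeasurableB|exact: ltW|].
    apply: aeW => x; rewrite /u3 cabsM mulrC ler_wpM2r ?cabs_ge0//.
    by apply: le_trans (FN x) _; rewrite lerDl.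
  apply: le_trans (lee_wpmul2l _ gn) _; first by rewrite lee_fin ltW.
  by rewrite -EFinM lee_fin invfM mulrCA (mulrC (N + 1)) -!mulrA mulVf ?lt0r_neq0// mulr1.
have -> : e%:E = ((e / 3)%:E + ((e / 3)%:E + (e / 3)%:E))%E.
  by rewrite -!EFinD; congr EFin; field.
apply: le_trans (cLnormD _ p1 m1 (cmeasurableD m2 m3)) _; apply: leeD b1 _.
by apply: le_trans (cLnormD _ p1 m2 m3) _; exact: leeD.
Unshelve. all: by end_near. Qed.

Lemma product_representation :
  souza_representation mu P s p (multiplier g f) product_coef product_atom /\
  (cost P p q product_coef < +oo)%E.
Proof.
have cfin : (cost P p q product_coef < +oo)%E.
  apply: le_lt_trans product_cost _.
  by rewrite lte_mul_pinfty ?lee_fin ?addr_ge0 ?divr_ge0 ?subr_ge0 ?(ltW r1)//.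
split=> //; split.
- by move=> k Q; exact: product_atomP.
- apply: (cLnorm_blocks_summable gg p1 s0 q1 _ cfin) => k Q; exact: product_atomP.
- exact: product_cvg.
Qed.

End product.

(** * From costs to norms *)

Lemma le_mul_ereal_inf (R : realType) (X : set \bar R) (y : \bar R) (M : R) :
  0 <= M -> X !=set0 -> (forall x, X x -> (y <= M%:E * x)%E) ->
  (y <= M%:E * ereal_inf X)%E.
Proof.
(* For [M = 0] a member of [X] is evaluated, since scaling by [M] is pushed into the infimum only
   for [M > 0]. *)
rewrite le_eqVlt => /predU1P[<- [x Xx] /(_ x Xx)|M0 _ yX]; first by rewrite !mul0e.
by rewrite -ereal_inf_pZl//; apply: le_ereal_inf_tmp => _ [x Xx <-]; exact: yX.
Qed.

Section multiplier.
Context (R : realType) (d : measure_display) (T : measurableType d).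
Context (mu : {finite_measure set T -> \bar R}) (l1 l2 : R) (P : nat -> set (set T)).
Context (p s : R) (q : \bar R).
Hypothesis gg : good_grid mu l1 l2 P.
Hypothesis p1 : 1 <= p.
Hypothesis q1 : (1 <= q)%E.
Implicit Types (f g : T -> R[i]) (c : set T -> R[i]).

Let p0 : 0 < p. Proof. by rewrite (lt_le_trans _ p1). Qed.

Lemma cost_ge0 c : (0 <= cost P p q c)%E.
Proof. by rewrite (costE _ gg); apply: seq_norm_ge0 => // k; exact: level_norm_ge0. Qed.

Lemma besov_norm_ge0 f : (0 <= besov_norm mu P s p q f)%E.
Proof. by apply: le_ereal_inf_tmp => _ [c _ <-]; exact: cost_ge0. Qed.

Lemma besov_norm_le (M : R) f (y : \bar R) : 0 <= M -> besov mu P s p q f ->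
  (forall c a, souza_representation mu P s p f c a -> (cost P p q c < +oo)%E ->
    (y <= M%:E * cost P p q c)%E) ->
  (y <= M%:E * besov_norm mu P s p q f)%E.
Proof.
move=> M0 [_ [c [a [fc cfin]]]] h; apply: le_mul_ereal_inf => //.
- by exists (cost P p q c); exists c => //; exists a.
- by move=> _ [c' [a' [fc' cfin']] <-]; exact: h fc' cfin'.
Qed.

Lemma besov_norm_fin f : besov mu P s p q f -> besov_norm mu P s p q f \is a fin_num.
Proof.
move=> [_ [c [a [fc cfin]]]]; rewrite ge0_fin_numE ?besov_norm_ge0//.
apply: le_lt_trans (cfin); apply: ereal_inf_lbound.
by exists c => //; exists a.
Qed.

End multiplier.

(** * Oscillation of the averages of the multiplier *)

Section oscillation.
Context (R : realType) (d : measure_display) (T : measurableType d).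
Context (mu : {finite_measure set T -> \bar R}) (l1 l2 : R) (P : nat -> set (set T)).
Context (p : R) (g : T -> R[i]).
Hypothesis gg : good_grid mu l1 l2 P.
Hypothesis p1 : 1 <= p.
Hypothesis gLp : cLp mu p%:E g.

Let p0 : 0 < p. Proof. by rewrite (lt_le_trans _ p1). Qed.

Lemma cL1_cLp : cL1 mu g.
Proof.
case: gLp => gm gfin; split=> //; have [C C0 hC] := cLnorm_L1 mu p1.
by apply: le_lt_trans (hC _ gm) _; rewrite lte_mul_pinfty ?lee_fin.
Qed.

Section atoms.
Context (c : set T -> R[i]) (a : set T -> T -> R[i]).
Hypothesis g_rep : souza_representation mu P (1 / p) p g c a.

Lemma souza_atom_le1 k Q x : P k Q -> cabs (a Q x) <= 1.
Proof.
case: g_rep => sa _ _ /sa[_ _ /(_ x)]; by rewrite div1r subrr powRr0.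
Qed.

Lemma souza_rep_step k : grid_step P k a.
Proof. by case: g_rep => sa _ _; exact: souza_grid_step (sa k). Qed.

Lemma souza_rep_cvg : absint mu setT
  (fun x => g x - \sum_(0 <= k < n) block P c a k x) @[n --> \oo] --> 0.
Proof.
have [gm _] := gLp; have [C C0 hC] := cLnorm_L1 mu p1.
have Lb k : cL1 mu (block P c a k).
  apply: (@cL1_block _ _ _ _ _ _ _ gg _ _ _ (fun=> 1)); first exact: souza_rep_step.
  by move=> Q x; exact: souza_atom_le1.
have LS n : cL1 mu (fun x => g x - \sum_(0 <= k < n) block P c a k x).
  by apply: cL1B; [exact: cL1_cLp|exact: cL1_sum].
suff /fine_cvgP[_] : (absint mu setT (fun x =>
    (g x - \sum_(0 <= k < n) block P c a k x)%R))%:E @[n --> \oo] --> (0 : R)%:E by [].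
apply: (@squeeze_cvge _ _ _ _ (fun=> 0%E) _ (fun n => C%:E *
   cLnorm mu p%:E (fun x => (g x - \sum_(0 <= k < n) block P c a k x)%R))%E).
- apply: nearW => n; rewrite lee_fin absint_ge0 andTb absintE//.
  by apply: hC; case: (LS n).
- exact: cvg_cst.
- have -> : ((0 : R)%:E = C%:E * 0)%E by rewrite mule0.
  apply: cvgeZl => //.
  by case: g_rep.
Qed.

End atoms.

(** The left side does not mention a representation, so the bound by the cost of each one passes to
    the infimum. With exponent [+oo] the cost is the supremum of the level norms, which is the
    uniform bound required by [lpsum_cavg_diff]. *)
Lemma oscillation_le k : besov mu P (1 / p) p +oo%E g ->
  lpsum (cells P k.+1) p (fun W => cabs (cavg mu g W - cavg mu g (parent P k W))) <=
  (1 + l1^-1 `^ p^-1) / (1 - l2 `^ p^-1) *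
  fine (besov_norm mu P (1 / p) p +oo%E g).
Proof.
move=> gB; have Nfin := besov_norm_fin (p := p) gg (leey 1%E) gB.
have l20 := l2_gt0 gg.
have t1 : l2 `^ p^-1 < 1 by rewrite (l2_powR_lt1 gg)// invr_gt0.
rewrite -lee_fin EFinM fineK//; apply: besov_norm_le => //.
  by apply: divr_ge0; [rewrite addr_ge0 ?powR_ge0|rewrite subr_ge0 ltW].
move=> c a g_rep cfin.
have c0 : (0 <= cost P p +oo%E c)%E by exact: (cost_ge0 _ gg (leey _)).
have cnum : cost P p +oo%E c \is a fin_num by rewrite ge0_fin_numE.
rewrite -(fineK cnum) -EFinM lee_fin.
apply: (lpsum_cavg_diff gg p1 cL1_cLp (souza_rep_step g_rep) (souza_atom_le1 g_rep)).
- move=> j; rewrite -lee_fin fineK// (costE _ gg).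
  by apply: (@le_seq_norm _ +oo%E (leey _)) => i; exact: level_norm_ge0.
- exact: souza_rep_cvg.
Qed.

End oscillation.

(** * Operator bound and comparison with [C_e] and [C_o] *)

Theorem proposition18p10 (R : realType) (d : measure_display)
    (T : measurableType d) (mu : {finite_measure set T -> \bar R})
    (lambda1 lambda2 : R) (P : nat -> set (set T))
    (p s : R) (q : \bar R) (g : T -> R[i]) :
  good_grid mu lambda1 lambda2 P ->
  1 <= p -> (1 <= q)%E -> 0 < s -> s < 1 / p ->
  besov mu P (1 / p) p +oo%E g -> cLp mu +oo%E g ->
  bounded_operator mu (besov mu P s p q) (besov_norm mu P s p q)
    (multiplier g) /\
  (operator_norm (besov mu P s p q) (besov_norm mu P s p q) (multiplier g)
   <= (C_e lambda1 lambda2 p)%:E * C_o mu P lambda2 p *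
      (besov_norm mu P (1 / p) p +oo%E g *
        ((1 - lambda2 `^ (1 / p - s))^-1)%:E)
      + cLnorm mu +oo%E g)%E.
Proof.
move=> gg p1 q1 s0 sp gB [gm gfin]; rewrite div1r in sp.
have p0 : 0 < p by rewrite (lt_le_trans _ p1).
have [gLp [cg [ag [g_rep _]]]] := gB.
have l10 := l1_gt0 gg; have l20 := l2_gt0 gg; have l21 := l2_lt1 gg.
have Gge0 : (0 <= cLnorm mu +oo%E g)%E by exact: Lnorm_ge0.
have Gnum : cLnorm mu +oo%E g \is a fin_num by rewrite ge0_fin_numE.
set G := fine (cLnorm mu +oo%E g).
have G0 : 0 <= G by exact: fine_ge0.
have gG : {ae mu, forall x, cabs (g x) <= G}.
  (* [Lnorm] at [+oo] is the essential supremum only on a space of positive measure; here the space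
     is itself a cell. *)
  have muT : (0 < mu setT)%E.
    by case: (gg) => _ [[_ h _] _]; have [] := h 0%N setT (cell_T gg).
  have := ess_sup_ge mu (abse \o (fun x => (cabs (g x))%:E)).
  apply: filterS => x; rewrite -lee_fin (fineK Gnum) /cLnorm unlock muT.
  by rewrite /= ger0_norm ?cabs_ge0.
set N := besov_norm mu P (1 / p) p +oo%E g.
have N0 : (0 <= N)%E by exact: (besov_norm_ge0 _ _ gg (leey _)).
have Nnum : N \is a fin_num by exact: (besov_norm_fin gg (leey _)).
(* [K <= C_e * C_o], because of the second term of [C_o] alone. *)
pose K := (1 + lambda1^-1 `^ p^-1) / (1 - lambda2 `^ p^-1).
have K0 : 0 <= K.
  apply: divr_ge0; first by rewrite addr_ge0 ?powR_ge0.
  by rewrite subr_ge0 ltW// (l2_powR_lt1 gg)// invr_gt0.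
pose D := K * fine N.
have D0 : 0 <= D by rewrite mulr_ge0 ?fine_ge0.
pose r := lambda2 `^ (p^-1 - s).
have r1 : r < 1 by rewrite (l2_powR_lt1 gg)// subr_gt0.
have r10 : 0 < 1 - r by rewrite subr_gt0.
pose M := G + D / (1 - r).
have M0 : 0 <= M by rewrite addr_ge0// divr_ge0// ltW.
have prod f c a : cmeasurable f -> souza_representation mu P s p f c a ->
    (cost P p q c < +oo)%E -> exists c' a',
    [/\ souza_representation mu P s p (multiplier g f) c' a',
        (cost P p q c' < +oo)%E & (cost P p q c' <= M%:E * cost P p q c)%E].
  move=> fm f_rep cfin.
  have ag1 k Q x : P k Q -> cabs (ag Q x) <= 1.
    exact: (souza_atom_le1 g_rep).
  have g_cvg := souza_rep_cvg gg p1 gLp g_rep.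
  have g_step := souza_rep_step g_rep.
  have gD k := oscillation_le gg p1 gLp k gB.
  have [h1 h2] := product_representation gg p1 q1 s0 sp gm G0 gG g_step ag1
    g_cvg D0 gD fm f_rep cfin.
  have h3 := product_cost gg p1 q1 sp gm G0 gG D0 gD f_rep cfin.
  exact: (ex_intro _ _ (ex_intro _ _ (And3 h1 h2 h3))).
have V f : besov mu P s p q f -> besov mu P s p q (multiplier g f).
  move=> [[fm ffin] [c [a [f_rep cfin]]]]; split.
    split; first exact: product_cmeasurable.
    apply: le_lt_trans (product_cLnorm_le p1 gm G0 gG fm) _.
    by rewrite lte_mul_pinfty ?lee_fin.
  by have [c' [a' [h1 h2 _]]] := prod f c a fm f_rep cfin; exists c', a'.
have bound f : besov mu P s p q f ->
    (besov_norm mu P s p q (multiplier g f) <= M%:E * besov_norm mu P s p q f)%E.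
  move=> fB; apply: besov_norm_le => // c a f_rep cfin.
  have [[fm _] _] := fB.
  have [c' [a' [h1 h2 h3]]] := prod f c a fm f_rep cfin.
  apply: le_trans h3; apply: ereal_inf_lbound; exists c' => //; by exists a'.
split; first split => //.
- by move=> f h _ _; apply: filterS => x fh; rewrite /multiplier fh.
- by move=> z f h _ _; apply: aeW => x; rewrite /multiplier mulrDr mulrCA.
- by exists M.
apply: ge_ereal_sup => _ [f [fB f1] <-].
apply: le_trans (bound f fB) _.
apply: (@le_trans _ _ (M%:E)).
  by rewrite -[leRHS]mule1 lee_wpmul2l// lee_fin.
rewrite /M addrC EFinD (fineK Gnum) leeD2r//.
have -> : lambda2 `^ (1 / p - s) = r by rewrite div1r.
rewrite -/N.
have -> : (D / (1 - r))%:E = ((1 + lambda1^-1 `^ p^-1)%:E *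
    ((1 - lambda2 `^ p^-1)^-1)%:E * (N * ((1 - r)^-1)%:E))%E.
  by rewrite /D /K -{2}(fineK Nnum) -!EFinM !mulrA.
have a0 : 0 <= 1 + lambda1^-1 `^ p^-1 by rewrite addr_ge0 ?powR_ge0.
have b0 : 0 <= (1 - lambda2 `^ p^-1)^-1.
  by rewrite invr_ge0 subr_ge0 ltW// (l2_powR_lt1 gg)// invr_gt0.
have X0 : (0 <= N * ((1 - r)^-1)%:E)%E.
  by rewrite mule_ge0// lee_fin invr_ge0 ltW.
have Y0 : (0 <= (1 + lambda1^-1 `^ p^-1)%:E * ((1 - lambda2 `^ p^-1)^-1)%:E)%E.
  by rewrite mule_ge0// lee_fin.
apply: (lee_pmul Y0 X0 _ (lexx _)).
apply: lee_pmul; rewrite ?lee_fin//.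
(* Since [C_H >= 1] and [lambda1 <= 1], lowering the exponent of [lambda1] from [-1/p] to [-2 - 1/p]
   only increases the power. *)
- rewrite /C_e lerD2l.
  have l11 : lambda1 <= 1 by case: (gg) => -[_ l12 _] _; exact: ltW (lt_trans l12 l21).
  have CH1 : 1 <= C_H lambda1 lambda2.
    by rewrite /C_H lerDr divr_ge0 ?mulr_ge0 ?powR_ge0 ?sqrtr_ge0.
  apply: (@le_trans _ _ (lambda1 `^ (- 2 - 1 / p))); last by rewrite ler_peMl ?powR_ge0.
  rewrite -powR_inv1 ?(ltW l10)// -powRrM mulN1r div1r.
  apply: ger_powR; first by rewrite l10.
  by rewrite gerDr.
- rewrite /C_o div1r div1r leeDr// mule_ge0 ?lee_fin ?powR_ge0//.
  by apply: nneseries_ge0 => k _ _; rewrite lee_fin powR_ge0.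
Qed.
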